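(* Let $0<\alpha<2$ and let $X(t)$, $t\in T$ ($T\ne\emptyset$), be a separable symmetric $\alpha$-stable process. Let $\rho(s,t)$ be the scale parameter of $X(t)-X(s)$, i.e. $\mathbb{E}\exp\{iu(X(t)-X(s))\}=\exp\{-\rho(t,s)^\alpha|u|^\alpha\}$, assume $\sigma=\operatorname{diam}(T,\rho)<\infty$ and $(T,\rho)$ relatively compact, and let $N(\varepsilon)$ be the covering numbers of $(T,\rho)$. Assume $N(\varepsilon)\le\Psi(\varepsilon)$ for all $\varepsilon>0$, where $\Psi$ is a non-increasing continuous function satisfying $$C_1\Psi(\varepsilon)\le\Psi(\varepsilon/2)\qquad\text{for all }0<\varepsilon\le\sigma,$$ for some $C_1>1$. Let $\widehat\Psi(\varepsilon)=\int_0^\varepsilon\big(\frac{\Psi(u)}{u}\big)^{\frac1{\alpha+1}}du$. Then $$\log\mathbb{P}\Big(\sup_{s,t\in T}|X(s)-X(t)|\le K_0\varepsilon\Big)\ge -K\,\varepsilon^{-\alpha}\,\widehat\Psi(\varepsilon)^{\alpha+1}\qquad\text{for all }\varepsilon>0,$$ with a universal constant $K_0>0$ and a constant $K>0$ depending only on $\alpha$ and $C_1$.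
   Context: A process is symmetric $\alpha$-stable if all its finite-dimensional distributions are symmetric $\alpha$-stable vectors. The covering number $N(\varepsilon)$ is the minimal number of points $t_1,\dots,t_n\in T$ such that every $t\in T$ has $\rho(t,t_i)\le\varepsilon$ for some $i$. *)

(* Defs.v *)
From HB Require Import structures.
From mathcomp Require Import all_boot all_order all_algebra.
From mathcomp Require Import all_classical all_reals all_analysis.
Set Implicit Arguments. Unset Strict Implicit. Unset Printing Implicit Defensive.
Import Order.TTheory GRing.Theory Num.Theory.
Import numFieldNormedType.Exports.
Local Open Scope classical_set_scope.
Local Open Scope ring_scope.

Section SaS.
Context {R : realType} {d : measure_display} {Omega : measurableType d}.
Variable P : probability Omega R.

(* A real random variable Y is symmetric alpha-stable with scale c >= 0 when
   E exp(i u Y) = exp(-(c |u|)^alpha) for all real u; written out as the real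
   and imaginary parts of the characteristic function. *)
Definition SaS_scale (alpha : R) (Y : Omega -> R) (c : R) : Prop :=
  0 <= c /\
  forall u : R,
    (\int[P]_w (cos (u * Y w))%:E = (expR (- ((c * `|u|) `^ alpha)))%:E)%E /\
    (\int[P]_w (sin (u * Y w))%:E = 0)%E.

Definition SaS_rv (alpha : R) (Y : Omega -> R) : Prop :=
  exists c, SaS_scale alpha Y c.

Definition SaS_vector (alpha : R) (n : nat) (Y : 'I_n -> Omega -> R) : Prop :=
  forall a : 'I_n -> R, SaS_rv alpha (fun w => \sum_(i < n) a i * Y i w).

Definition SaS_process (alpha : R) (T : Type) (X : T -> Omega -> R) : Prop :=
  (forall t, measurable_fun setT (X t)) /\
  forall (n : nat) (ts : 'I_n -> T), SaS_vector alpha (fun i => X (ts i)).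

Definition separable_process (T : Type) (rho : T -> T -> R)
    (X : T -> Omega -> R) : Prop :=
  exists S : set T, countable S /\
  exists N : set Omega, measurable N /\ P N = 0%E /\
  forall w, ~ N w -> forall t : T, exists s : nat -> T,
    (forall k, S (s k)) /\
    ((fun k => rho (s k) t) @ \oo --> (0 : R)) /\
    ((fun k => X (s k) w) @ \oo --> X t w).

End SaS.

Definition covers {R : realType} {T : Type} (rho : T -> T -> R) (eps : R)
    (n : nat) : Prop :=
  exists f : 'I_n -> T, forall t : T, exists i : 'I_n, rho t (f i) <= eps.

Definition covering_number {R : realType} {T : Type} (rho : T -> T -> R)
    (eps : R) : nat :=
  match pselect (exists n, covers rho eps n) with
  | left h => ex_minn (P := fun n => `[< covers rho eps n >])
                (let: ex_intro n hn := h in ex_intro _ n (asboolT hn))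
  | right _ => 0%N
  end.

(* (T, rho) is relatively compact, i.e. totally bounded. *)
Definition totally_bounded_pm {R : realType} {T : Type}
    (rho : T -> T -> R) : Prop :=
  forall eps : R, 0 < eps -> exists n, covers rho eps n.

Definition diam_pm {R : realType} {T : Type} (rho : T -> T -> R) : R :=
  sup (range (fun p : T * T => rho p.1 p.2)).

Definition Psi_hat {R : realType} (alpha : R) (Psi : R -> R) (eps : R)
    : \bar R :=
  let D : set R := `]0, eps]%classic in
  (\int[lebesgue_measure]_(u in D) ((Psi u / u) `^ (1 / (alpha + 1)))%:E)%E.

(* Main.v *)
(* A lower bound for the probability that the chaining increments of a stable
   process are small follows from a Sidak-type inequality
     P(|Z_1| <= 2, ..., |Z_n| <= 2) >= prod_i E B(Z_i)
   for jointly symmetric stable Z_i, where B <= 1_[-2,2] is the cubic B-spline.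
   Write E cos(u Z) = exp(- psi(Z) |u|^alpha). Letting t -> 0 in
   E (1 - cos(tY)) (1 - cos(tZ)) >= 0 gives
   psi(Y + Z) + psi(Y - Z) <= 2 psi(Y) + 2 psi(Z). Since a product of cosines is
   an average of cosines of signed sums, convexity of exp then yields
   E prod_i cos(u_i Z_i) >= prod_i E cos(u_i Z_i), and integrating each u_i
   against the nonnegative Fourier transform (1 - cos u)^2 / u^4 of B gives the
   inequality. Each factor E B(Z) is at least exp(- M psi(Z)), because the
   Fourier weight has a finite second moment and alpha < 2, and it decays only
   like psi(Z)^(-1/alpha) when psi(Z) is large.

   The increments between the nets of radii e 2^(j+1) and e 2^j, j >= 0, get the
   tolerance e 2^(-j): their cost is O(j + 1) each, and there are at most
   Psi(e 2^j) <= C1^(-j) Psi(e) of them. Below the radius e, the net of radius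
   x = e 2^(-k) gets a tolerance proportional to
   theta(x) = (Psi(x) x^alpha)^(1/(alpha+1)), which is summable because
   sum_k theta(e 2^(-k)) <= 2 Psi_hat(e); this choice minimises the total cost. *)

Require Import Defs.
From HB Require Import structures.
From mathcomp Require Import all_boot all_order all_algebra.
From mathcomp Require Import all_classical all_reals all_analysis.
From mathcomp Require Import measurable_realfun ring lra.
Import Order.TTheory GRing.Theory Num.Theory.
Import numFieldNormedType.Exports.
Local Open Scope classical_set_scope.
Local Open Scope ring_scope.
Set Implicit Arguments. Unset Strict Implicit. Unset Printing Implicit Defensive.

(** * A compactly supported spline with a nonnegative Fourier transform *)

Section elementary.
Context {R : realType}.
Implicit Types x y u r : R.

Lemma eq_ler x y : x = y -> x <= y.
Proof. by move=> ->. Qed.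

Lemma sin_lex x : 0 <= x -> sin x <= x.
Proof.
move=> x0.
have d z : z \in `]0, x[%R -> is_derive z 1 (sin : R -> R) (cos z).
  by move=> _; exact: is_derive_sin.
have c : {within `[0, x], continuous (sin : R -> R)}.
  by apply: continuous_subspaceT => z; exact: continuous_sin.
have [z _] := MVT_segment x0 d c.
rewrite sin0 !subr0 => ->; rewrite ler_piMl// cos_le1.
Qed.

Lemma cos_ge x : 1 - x ^+ 2 / 2 <= cos x.
Proof.
wlog x0 : x / 0 <= x.
  move=> H; have [/H //|/ltW x0] := leP 0 x.
  by rewrite -cosN -sqrrN; apply: H; rewrite oppr_ge0.
have -> : cos x = 1 - 2 * sin (x / 2) ^+ 2.
  by rewrite {1}[x]splitr cosD -!expr2 cos2sin2; ring.
have s1 : - (x / 2) <= sin (x / 2).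
  have [h|h] := leP (x / 2) pi.
    apply: (@le_trans _ _ 0); first by lra.
    by apply: sin_ge0_pi; apply/andP; split => //; lra.
  have := sin_geN1 (x / 2); have := @pi_ge2 R; lra.
have s2 : sin (x / 2) <= x / 2 by apply: sin_lex; lra.
nra.
Qed.

Lemma x_sin_le x : 0 <= x -> x - sin x <= x ^+ 3 / 2.
Proof.
move=> x0.
have d z : z \in `]0, x[%R -> is_derive z 1 (id - sin : R -> R) (1 - cos z).
  by move=> _; apply: is_deriveB.
have c : {within `[0, x], continuous (id - sin : R -> R)}.
  apply: continuous_subspaceT => z; apply: cvgB; [exact: cvg_id|exact: continuous_sin].
have [z + ] := MVT_segment x0 d c.
rewrite in_itv/= => /andP[z0 zx] /=.
rewrite !fctE /= sin0 !subr0 => ->.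
have := cos_ge z => h.
have : z ^+ 2 <= x ^+ 2 by rewrite lerXn2r// ?nnegrE// (le_trans z0).
move: (z ^+ 2) h => z2 h h2.
have : 1 - cos z <= x ^+ 2 / 2 by lra.
move=> /(ler_wpM2r x0) h3; apply: (le_trans h3).
by rewrite (exprSr x 2); lra.
Qed.

(** The Taylor remainder of the cosine after the quadratic term. It is O(x^4) near 0 and O(x^2) at
    infinity, which makes its quotient by x^4 integrable over the line. *)
Definition cos_rem x : R := cos x - 1 + x ^+ 2 / 2.

Lemma cos_rem_ge0 x : 0 <= cos_rem x.
Proof. by rewrite /cos_rem; have := cos_ge x; lra. Qed.

Lemma cos_remN x : cos_rem (- x) = cos_rem x.
Proof. by rewrite /cos_rem cosN sqrrN. Qed.

(** With y = x / 2 the remainder is 2 (y - sin y) (y + sin y); for y >= 0 the factors are at most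
    y^3 / 2 and 2 y. *)
Lemma cos_rem_le4 x : cos_rem x <= x ^+ 4 / 8.
Proof.
wlog x0 : x / 0 <= x.
  move=> H; have [/H //|/ltW x0] := leP 0 x.
  rewrite -cos_remN (_ : x ^+ 4 = (- x) ^+ 4); last by rewrite !exprS expr0; ring.
  by apply: H; rewrite oppr_ge0.
rewrite /cos_rem.
have -> : cos x = 1 - 2 * sin (x / 2) ^+ 2.
  by rewrite {1}[x]splitr cosD -!expr2 cos2sin2; ring.
have y0 : 0 <= x / 2 by lra.
have s2 := sin_lex y0; have s3 := x_sin_le y0.
have -> : x ^+ 4 = 16 * (x / 2) ^+ 4.
  by rewrite exprMn exprVn; field.
rewrite (_ : x ^+ 2 = 4 * (x / 2) ^+ 2); last by rewrite exprMn exprVn; field.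
move: (x / 2) y0 s2 s3 => y y0 s2 s3.
set s := sin y in s2 s3 *.
have h : (y - s) * (y + s) <= (y ^+ 3 / 2) * (2 * y).
  have : (y - s) * (y + s) <= (y - s) * (2 * y) by apply: ler_wpM2l; lra.
  move=> h1; apply: (le_trans h1); apply: ler_wpM2r => //; lra.
rewrite (_ : y ^+ 4 = y ^+ 3 * y); last by rewrite exprSr.
rewrite !expr2 in h *; lra.
Qed.

Lemma cos_rem_le2 x : cos_rem x <= x ^+ 2 / 2.
Proof. by rewrite /cos_rem; have := cos_le1 x; lra. Qed.

Lemma onem_cos_le2 x : 1 - cos x <= x ^+ 2 / 2.
Proof. by have := cos_ge x; lra. Qed.

End elementary.

(** * Lebesgue integrals on the line: domination and scaling *)

Section leb.
Context {R : realType}.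
Implicit Types (x y u r : R) (f : R -> R).
Local Notation mu := (@lebesgue_measure R).

Lemma measurable_funVr : measurable_fun [set: R] (GRing.inv : R -> R).
Proof.
have -> : [set: R] = [set 0] `|` [set x | x != 0].
  apply/seteqP; split => // x _ /=; have [->|x0] := eqVneq x 0; [by left|by right].
have o : open [set x : R | x != 0].
  rewrite (_ : mkset _ = ~` [set 0]); last first.
    by apply/seteqP; split => x /=; [move/eqP|move=> h; apply/eqP].
  exact/closed_openC/closed_eq.
apply/measurable_funU => //; first exact: open_measurable.
split; first exact: measurable_fun_set1.
apply: open_continuous_measurable_fun => // x; rewrite inE/= => x0.
exact: inv_continuous.
Qed.

Lemma integrable_oneDsqrV : mu.-integrable setT (fun x : R => ((oneDsqr x)^-1)%:E).
Proof.
apply/integrableP; split.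
  apply/measurable_EFinP; apply: continuous_measurable_fun.
  exact: (@continuous_oneDsqrV R).
under eq_integral do rewrite abse_EFin ger0_norm ?invr_ge0//.
rewrite ge0_symfun_integralT.
- rewrite (_ : [set x : R | 0 <= x] = `[0, +oo[%classic); last first.
    by rewrite set_itvE.
  by rewrite integral0y_oneDsqr -EFinM ltry.
- by move=> x; rewrite invr_ge0.
- exact: continuous_oneDsqrV.
- by move=> x /=; rewrite /oneDsqr sqrrN.
Qed.

Lemma integrable_le_oneDsqrV f (C : R) : measurable_fun setT f ->
  (forall x, `|f x| <= C * (oneDsqr x)^-1) -> mu.-integrable setT (EFin \o f).
Proof.
move=> mf fC.
have iC := integrableZl measurableT C integrable_oneDsqrV.
apply: le_integrable iC => //.
- exact/measurable_EFinP.
- by move=> x _ /=; rewrite lee_fin (le_trans (fC x))// ler_norm.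
Qed.

(** The scaled pushforward agrees with Lebesgue measure on half-open intervals, and these determine
    the measure. *)
Lemma lebesgue_measure_scale r (A : set R) : 0 < r -> measurable A ->
  mu A = (r%:E * mu (( *%R r) @^-1` A))%E.
Proof.
move=> r0 mA.
have mr : measurable_fun [set: R] ( *%R r : R -> measurableTypeR R).
  by apply: continuous_measurable_fun => x; exact: mulrl_continuous.
pose m := mscale (NngNum (ltW r0)) (pushforward mu ( *%R r : R -> measurableTypeR R)).
have -> : (r%:E * mu ( *%R r @^-1` A))%E = m mr A by [].
rewrite /m; apply: lebesgue_measure_unique mA => _ [[a b]] _ <-.
have pre : *%R r @^-1` `]a, b]%classic = `]a / r, b / r]%classic.
  apply/seteqP; split => x /=; rewrite !in_itv/= ltr_pdivrMr// ler_pdivlMr//;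
    by rewrite mulrC.
rewrite -[RHS]/(r%:E * mu ( *%R r @^-1` `]a, b]%classic))%E pre.
rewrite !lebesgue_measure_itv/= !lte_fin ltr_pM2r ?invr_gt0//.
case: ifP => _; last by rewrite mule0.
by rewrite -EFinD -EFinB -EFinM mulrBr !(mulrCA r) divff ?gt_eqF// !mulr1.
Qed.

Lemma ge0_integral_scale r f : 0 < r -> measurable_fun setT f ->
  (forall x, 0 <= f x) ->
  (\int[mu]_x (f x)%:E = r%:E * \int[mu]_x (f (r * x))%:E)%E.
Proof.
move=> r0 mf f0.
have mr : measurable_fun [set: R] ( *%R r : R -> measurableTypeR R).
  by apply: continuous_measurable_fun => x; exact: mulrl_continuous.
pose m := mscale (NngNum (ltW r0)) (pushforward mu ( *%R r : R -> measurableTypeR R)).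
rewrite (@eq_measure_integral _ _ _ _ (m mr)); last first.
  by move=> A mA _; exact: lebesgue_measure_scale.
rewrite /m ge0_integral_mscale//=; first last.
- by move=> x _; rewrite lee_fin.
- exact/measurable_EFinP.
rewrite ge0_integral_pushforward//.
- exact/measurable_EFinP.
- by move=> x _; rewrite lee_fin.
Qed.

End leb.

Section rintegral.
Context d (T : measurableType d) (R : realType) (m : {measure set T -> \bar R}).
Implicit Types f g : T -> R.

Lemma integrable_lincomb (a : R) f g :
  m.-integrable setT (EFin \o f) -> m.-integrable setT (EFin \o g) ->
  m.-integrable setT (EFin \o (fun x => a * f x + g x)).
Proof.
move=> fi gi; have := integrableD measurableT (integrableZl measurableT a fi) gi.
exact.
Qed.

Lemma Rintegral_lincomb (a : R) f g :
  m.-integrable setT (EFin \o f) -> m.-integrable setT (EFin \o g) ->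
  Rintegral m setT (fun x => a * f x + g x) =
  a * Rintegral m setT f + Rintegral m setT g.
Proof.
move=> fi gi; have afi := integrableZl measurableT a fi.
rewrite RintegralD//; congr (_ + _); exact: RintegralZl.
Qed.

End rintegral.

(** * The spline and its Fourier weight *)

Section kernel.
Context {R : realType}.
Implicit Types (x y u r : R).
Local Notation mu := (@lebesgue_measure R).

(** Since 1 - cos u = 2 sin^2(u/2), this is a fourth power of sinc up to a constant. At [u = 0]
    division by zero gives 0 instead of the limit 1/4, which does not affect integrals. *)
Definition bker u : R := (1 - cos u) ^+ 2 / u ^+ 4.
Definition crem r u : R := cos_rem (r * u) / u ^+ 4.
Definition bker_mass : R := Rintegral mu setT bker.
(** The cubic B-spline with knots -2, ..., 2, as the fourth central difference of the cubed absolute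
    value; dividing by 8 makes its value at 0 equal to 1. *)
Definition bspl y : R :=
  (`|y - 2| ^+ 3 - 4 * `|y - 1| ^+ 3 + 6 * `|y| ^+ 3 - 4 * `|y + 1| ^+ 3
   + `|y + 2| ^+ 3) / 8.

Lemma expr4_ge0 u : 0 <= u ^+ 4.
Proof. by rewrite exprn_even_ge0. Qed.

Lemma bker_ge0 u : 0 <= bker u.
Proof. by rewrite mulr_ge0 ?sqr_ge0// invr_ge0 expr4_ge0. Qed.

Lemma crem_ge0 r u : 0 <= crem r u.
Proof. by rewrite mulr_ge0 ?cos_rem_ge0// invr_ge0 expr4_ge0. Qed.

Lemma measurable_exprVn n : measurable_fun [set: R] (fun u : R => u ^- n).
Proof.
apply: (measurableT_comp measurable_funVr).
exact: measurable_funX.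
Qed.

Lemma measurable_cos : measurable_fun [set: R] (cos : R -> R).
Proof. by apply: continuous_measurable_fun => x; exact: continuous_cos. Qed.

Lemma measurable_bker : measurable_fun [set: R] bker.
Proof.
apply: measurable_funM; last exact: measurable_exprVn.
apply: measurable_funX; apply: measurable_funB => //; exact: measurable_cos.
Qed.

Lemma measurable_crem r : measurable_fun [set: R] (crem r).
Proof.
apply: measurable_funM; last exact: measurable_exprVn.
have mr : measurable_fun [set: R] ( *%R r).
  by apply: continuous_measurable_fun => x; exact: mulrl_continuous.
apply: measurable_funD.
  apply: measurable_funB => //.
  exact: measurableT_comp measurable_cos _.
apply: measurable_funM => //; exact: measurable_funX.
Qed.

Lemma ler_pdivr_oneDsqr u (a C : R) : 0 <= C ->
  (1 + u ^+ 2) * a <= C * u ^+ 4 -> a / u ^+ 4 <= C * (oneDsqr u)^-1.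
Proof.
move=> C0 h; have o : 0 < oneDsqr u by apply: lt_le_trans (oneDsqr_ge1 u).
rewrite ler_pdivlMr//.
have [->|u0] := eqVneq u 0; first by rewrite expr0n invr0 mulr0 mul0r.
have u4 : 0 < u ^+ 4 by rewrite exprn_even_gt0.
by rewrite mulrAC ler_pdivrMr// mulrC.
Qed.

(** The factor 1 + u^2 provides the second moment of the weight. From 1 - cos u <= u^2 / 2 and 1 -
    cos u <= 2 follows (1 + u^2) (1 - cos u) <= 5/2 u^2, whose square is below 7 u^4. *)
Lemma bker_le u : (1 + u ^+ 2) * bker u <= 7 * (oneDsqr u)^-1.
Proof.
rewrite /bker mulrA; apply: ler_pdivr_oneDsqr => //.
rewrite mulrA -expr2 -exprMn.
rewrite (_ : 7 * u ^+ 4 = 28 / 4 * (u ^+ 2) ^+ 2); last by rewrite -exprM; field.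
have := onem_cos_le2 u; have := cos_geN1 u; have := cos_le1 u.
have := sqr_ge0 u.
move: (u ^+ 2) (cos u) => v c v0 c1 c2 c3.
have : (1 + v) * (1 - c) <= 5 / 2 * v by nra.
have : 0 <= (1 + v) * (1 - c) by apply: mulr_ge0; lra.
move: (_ * _) => a a0 a1; nra.
Qed.

Lemma crem_le r u : crem r u <= (r ^+ 4 / 8 + r ^+ 2 / 2) * (oneDsqr u)^-1.
Proof.
apply: ler_pdivr_oneDsqr.
  by rewrite addr_ge0// mulr_ge0// ?expr4_ge0 ?sqr_ge0.
have h4 := cos_rem_le4 (r * u); have h2 := cos_rem_le2 (r * u).
rewrite mulrDl mul1r mulrDl; apply: lerD; first by rewrite mulrAC -exprMn.
apply: (le_trans (ler_wpM2l (sqr_ge0 u) h2)).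
by rewrite exprMn; apply: eq_ler;
  rewrite (_ : u ^+ 4 = u ^+ 2 * u ^+ 2) -?exprD//; ring.
Qed.

Lemma bker_ge u : 0 < u -> u <= 1 -> 1 / 8 <= bker u.
Proof.
move=> u0 u1; rewrite ler_pdivlMr ?exprn_gt0//.
have : cos u <= 1 - u ^+ 2 / 2 + u ^+ 4 / 8.
  have := cos_rem_le4 u; rewrite /cos_rem; lra.
have : u ^+ 4 = u ^+ 2 * u ^+ 2 by rewrite -exprD.
move=> ->; have : u ^+ 2 <= 1 by rewrite expr_le1// ltW.
have := sqr_ge0 u.
move: (u ^+ 2) (cos u) => v c v0 v1 h.
(* The constant works because (3/8)^2 exceeds 1/8. *)
have : 3 / 8 * v <= 1 - c by nra.
move=> h3; have : 0 <= 3 / 8 * v by lra.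
move: (1 - c) h3 => a h3 h4; nra.
Qed.

Lemma integrable_crem r : mu.-integrable setT (EFin \o crem r).
Proof.
apply: integrable_le_oneDsqrV; first exact: measurable_crem.
by move=> u; rewrite ger0_norm ?crem_ge0//; exact: crem_le.
Qed.

Lemma integrable_bkerM (f : R -> R) : measurable_fun setT f ->
  (forall u, `|f u| <= 1 + u ^+ 2) ->
  mu.-integrable setT (EFin \o (fun u => bker u * f u)).
Proof.
move=> mf f1; apply: (@integrable_le_oneDsqrV _ _ 7).
  exact: measurable_funM measurable_bker mf.
move=> u; apply: le_trans (bker_le u); rewrite normrM ger0_norm ?bker_ge0//.
by rewrite mulrC; apply: ler_wpM2r => //; exact: bker_ge0.
Qed.

(** For r > 0, [crem r u] is r^4 times [crem 1 (r * u)], and rescaling the variable absorbs one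
    factor r. The integral of [crem 1] itself is never evaluated. *)
Lemma integral_crem r :
  Rintegral mu setT (crem r) = `|r| ^+ 3 * Rintegral mu setT (crem 1).
Proof.
wlog r0 : r / 0 <= r.
  move=> H; have [/H //|/ltW r0] := leP 0 r.
  rewrite -normrN -H ?oppr_ge0//; apply: eq_Rintegral => u _.
  by rewrite /crem mulNr cos_remN.
rewrite ger0_norm//; move: r0; rewrite le_eqVlt => /predU1P[<-|r0].
  rewrite expr0n mul0r -[RHS](mul0r (fine (mu setT))) -Rintegral_cst//.
  apply: eq_Rintegral => u _.
  by rewrite /crem /cos_rem mul0r cos0 subrr expr0n !mul0r addr0 mul0r.
rewrite /Rintegral (ge0_integral_scale r0 (measurable_crem 1)); last first.
  by move=> u; exact: crem_ge0.
have -> : (\int[mu]_x (crem r x)%:E = (r ^+ 4)%:E * \int[mu]_x (crem 1 (r * x))%:E)%E.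
  rewrite -ge0_integralZl//=.
  - apply: eq_integral => u _; rewrite -EFinM; congr EFin.
    rewrite /crem mul1r [(r * u) ^+ 4]exprMn mulrA -mulf_div divff ?mul1r//.
    by rewrite expf_neq0// gt_eqF.
  - apply/measurable_EFinP; apply: (measurableT_comp (measurable_crem 1)).
    by apply: continuous_measurable_fun => x; exact: mulrl_continuous.
  - by move=> x _; rewrite lee_fin crem_ge0.
  - by rewrite lee_fin expr4_ge0.
rewrite exprSr EFinM -muleA -(ge0_integral_scale r0 (measurable_crem 1)); last first.
  by move=> u; exact: crem_ge0.
by rewrite fineM//; exact: (integrable_fin_num measurableT (integrable_crem 1)).
Qed.

(** Multiplying cos(uy) by 4 (1 - cos u)^2 amounts to taking its fourth central difference in y.
    That difference annihilates quadratic polynomials, so each cosine may be replaced by [cos_rem],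
    whose quotient by u^4 is integrable. *)
Lemma bker_cosE u y : bker u * cos (u * y) =
  1 / 4 * (crem (y - 2) u + - 4 * (crem (y - 1) u) + 6 * (crem y u)
    + - 4 * (crem (y + 1) u) + crem (y + 2) u).
Proof.
have E : (1 - cos u) ^+ 2 * cos (u * y) =
    1 / 4 * (cos_rem ((y - 2) * u) + - 4 * cos_rem ((y - 1) * u)
    + 6 * cos_rem (y * u) + - 4 * cos_rem ((y + 1) * u) + cos_rem ((y + 2) * u)).
  rewrite /cos_rem (mulrC u y).
  have -> : (y - 2) * u = y * u - (u + u) by ring.
  have -> : (y + 2) * u = y * u + (u + u) by ring.
  have -> : (y - 1) * u = y * u - u by ring.
  have -> : (y + 1) * u = y * u + u by ring.
  by rewrite !cosB !cosD !sinD -!expr2 sin2cos2; field.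
rewrite /bker mulrAC E /crem; move: (u ^- 4) => i; ring.
Qed.

Lemma bspl_fourier_mass y :
  Rintegral mu setT (fun u => bker u * cos (u * y)) =
  2 * Rintegral mu setT (crem 1) * bspl y.
Proof.
have i1 := integrable_crem.
have i2 := integrable_lincomb (- 4) (i1 (y + 1)) (i1 (y + 2)).
have i3 := integrable_lincomb 6 (i1 y) i2.
have i4 := integrable_lincomb (- 4) (i1 (y - 1)) i3.
have i5 := integrable_lincomb 1 (i1 (y - 2)) i4.
transitivity (Rintegral mu setT (fun u => 1 / 4 * (1 * crem (y - 2) u +
  (- 4 * crem (y - 1) u + (6 * crem y u + (- 4 * crem (y + 1) u
   + crem (y + 2) u)))))).
  by apply: eq_Rintegral => u _; rewrite bker_cosE; ring.
rewrite RintegralZl//.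
rewrite (Rintegral_lincomb _ (i1 _) i4) (Rintegral_lincomb _ (i1 _) i3).
rewrite (Rintegral_lincomb _ (i1 _) i2) (Rintegral_lincomb _ (i1 _) (i1 _)).
by rewrite (integral_crem y) !(integral_crem (y + _)) /bspl; field.
Qed.

Lemma bspl0 : bspl 0 = 1.
Proof.
rewrite /bspl !add0r normr0 !normrN !ger0_norm//.
by rewrite !exprS expr0; field.
Qed.

(** The transform at y = 0, where the spline is 1, identifies the unknown constant. *)
Lemma bker_massE : bker_mass = 2 * Rintegral mu setT (crem 1).
Proof.
have := bspl_fourier_mass 0; rewrite bspl0 mulr1 => <-.
apply: eq_Rintegral => u _.
by rewrite mulr0 cos0 mulr1.
Qed.

Lemma bspl_fourier y :
  Rintegral mu setT (fun u => bker u * cos (u * y)) = bker_mass * bspl y.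
Proof. by rewrite bspl_fourier_mass bker_massE. Qed.

Lemma bsplN y : bspl (- y) = bspl y.
Proof.
rewrite /bspl normrN.
rewrite -(normrN (- y - 2)) -(normrN (- y - 1)) -(normrN (- y + 1)) -(normrN (- y + 2)).
rewrite !opprD !opprK; ring.
Qed.

Lemma bspl_ge0 y : 0 <= bspl y.
Proof.
wlog y0 : y / 0 <= y.
  by move=> H; have [/H //|/ltW y0] := leP 0 y; rewrite -bsplN H// oppr_ge0.
rewrite /bspl; apply: divr_ge0 => //.
have p1 : 0 <= y + 1 by lra.
have p2 : 0 <= y + 2 by lra.
rewrite (ger0_norm y0) (ger0_norm p1) (ger0_norm p2).
have [y2|y2] := leP 2 y.
  rewrite !ger0_norm; [|lra|lra].
  by apply: eq_ler; ring.
rewrite (ltr0_norm (_ : y - 2 < 0)); last by lra.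
have [y1|y1] := leP 1 y.
  rewrite (@ger0_norm _ (y - 1)); last by lra.
  have -> : (- (y - 2)) ^+ 3 - 4 * (y - 1) ^+ 3 + 6 * y ^+ 3 - 4 * (y + 1) ^+ 3
    + (y + 2) ^+ 3 = 2 * (2 - y) ^+ 3 by ring.
  by rewrite mulr_ge0// exprn_ge0//; lra.
rewrite (ltr0_norm (_ : y - 1 < 0)); last by lra.
(* Rewritten so that 2 (1 - y) <= 2 - y makes both terms nonnegative. *)
have -> : (- (y - 2)) ^+ 3 - 4 * (- (y - 1)) ^+ 3 + 6 * y ^+ 3 - 4 * (y + 1) ^+ 3
    + (y + 2) ^+ 3 = 2 * ((2 - y) ^+ 3 - (2 * (1 - y)) ^+ 3) + 8 * (1 - y) ^+ 3 by ring.
rewrite addr_ge0// mulr_ge0//; last by rewrite exprn_ge0//; lra.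
by rewrite subr_ge0 lerXn2r// ?nnegrE; lra.
Qed.

Lemma bspl_eq0 y : 2 <= `|y| -> bspl y = 0.
Proof.
wlog y0 : y / 0 <= y.
  move=> H; have [/H //|/ltW y0] := leP 0 y.
  by rewrite -bsplN -normrN => /H ->//; rewrite oppr_ge0.
rewrite ger0_norm// => y2; rewrite /bspl !ger0_norm; by [field|lra].
Qed.

Lemma integrable_bker : mu.-integrable setT (EFin \o bker).
Proof.
have := @integrable_bkerM (cst 1) (measurable_cst _).
have -> : (fun u => bker u * cst 1 u) = bker by apply/funext => u; rewrite mulr1.
by apply => u; rewrite normr1 lerDl sqr_ge0.
Qed.

(** Keeps only the interval from 0 to x, where the weight is at least 1/8. It gives the positivity
    of the mass and the lower bound for strongly spread variables. *)
Lemma bker_mass_ge x : 0 <= x -> x <= 1 -> forall f : R -> R,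
  measurable_fun setT f -> (forall u, 0 <= f u <= 1) ->
  forall e, 0 <= e -> (forall u, 0 < u -> u <= x -> e <= f u) ->
  x / 8 * e <= Rintegral mu setT (fun u => bker u * f u).
Proof.
move=> x0 x1 f mf f01 e e0 ef.
have fi : mu.-integrable setT (EFin \o (fun u => bker u * f u)).
  apply: integrable_bkerM => // u; have /andP[f0 f1] := f01 u.
  by rewrite ger0_norm// (le_trans f1)// lerDl sqr_ge0.
have h : (\int[mu]_(u in `]0%R, x]) (e / 8)%:E <= \int[mu]_u (bker u * f u)%:E)%E.
  apply: (@le_trans _ _ (\int[mu]_(u in `]0%R, x]) (bker u * f u)%:E)%E).
    apply: ge0_le_integral => //.
    - by move=> u _; rewrite lee_fin divr_ge0.
    - apply/measurable_EFinP; apply: measurable_funTS.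
      exact: measurable_funM measurable_bker mf.
    - move=> u /=; rewrite in_itv/= => /andP[u0 ux]; rewrite lee_fin mulrC.
      have := bker_ge u0 (le_trans ux x1); have := ef _ u0 ux.
      move=> h1 h2; have := bker_ge0 u.
      by move: (bker u) (f u) h1 h2 => b c h1 h2 b0; nra.
  apply: ge0_subset_integral => //.
  - apply/measurable_EFinP; exact: measurable_funM measurable_bker mf.
  - by move=> u _; rewrite lee_fin mulr_ge0 ?bker_ge0//; have /andP[] := f01 u.
move: h; rewrite integral_cst//= lebesgue_measure_itv/= lte_fin.
rewrite -(fineK (integrable_fin_num measurableT fi)).
case: ifPn => [x00|]; first by rewrite sube0 -EFinM lee_fin; apply: le_trans; lra.
rewrite -leNgt => x0'; have -> : x = 0 by lra.
by rewrite mule0 lee_fin mul0r mul0r.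
Qed.

Lemma bker_mass_gt0 : 0 < bker_mass.
Proof.
have := @bker_mass_ge 1 ler01 (lexx _) (cst 1) (measurable_cst _) _ 1 ler01.
have -> : (fun u => bker u * cst 1 u) = bker by apply/funext => u; rewrite mulr1.
move=> h; apply: (@lt_le_trans _ _ (1 / 8 * 1)); first by lra.
by apply: h => // u; rewrite ler01 lexx.
Qed.

(** In the Fourier representation the cosine is at most 1. *)
Lemma bspl_le1 y : bspl y <= 1.
Proof.
rewrite -(ler_pM2l bker_mass_gt0) -bspl_fourier mulr1.
have cosb u : `|cos (u * y)| <= 1 + u ^+ 2.
  by apply: (@le_trans _ _ 1);
    [rewrite ler_norml cos_geN1 cos_le1|rewrite lerDl sqr_ge0].
apply: le_Rintegral => //; [|exact: integrable_bker|].
  apply: integrable_bkerM => //; apply: measurableT_comp measurable_cos _.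
  exact: measurable_funM.
by move=> u _; rewrite ler_piMr ?bker_ge0 ?cos_le1.
Qed.

Lemma measurable_bspl : measurable_fun [set: R] bspl.
Proof.
have mc (c : R) : measurable_fun [set: R] (fun y => `|y + c| ^+ 3).
  apply: measurable_funX; apply: measurableT_comp => //.
  exact: measurable_funD.
apply: measurable_funM => //; apply: measurable_funD => //.
apply: measurable_funB; last exact: measurable_funM.
apply: measurable_funD; last first.
  by apply: measurable_funM => //; apply: measurable_funX; exact: normr_measurable.
by apply: measurable_funB; [exact: mc|exact: measurable_funM].
Qed.

End kernel.

(** * A Sidak-type inequality for symmetric stable vectors *)

Section bounded_expectation.
Context d (Omega : measurableType d) (R : realType) (P : probability Omega R).
Implicit Types (f g H Z : Omega -> R).
Local Notation mu := (@lebesgue_measure R).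
Local Notation Ex f := (Rintegral P setT f).

Lemma integrable_bounded f (b : R) : measurable_fun setT f ->
  (forall w, `|f w| <= b) -> P.-integrable setT (EFin \o f).
Proof.
move=> mf fb; apply: measurable_bounded_integrable => //.
  by rewrite (le_lt_trans (probability_le1 P measurableT))// ltry.
by exists b; split; [exact: num_real|move=> M bM w _; exact: le_trans (fb w) (ltW bM)].
Qed.

Lemma Ex_cst (c : R) : Ex (fun=> c) = c.
Proof.
have e : (P : {measure set Omega -> \bar R}) setT = 1%E := probability_setT P.
by rewrite Rintegral_cst// e mulr1.
Qed.

Lemma le_Ex f g (b : R) : measurable_fun setT f -> measurable_fun setT g ->
  (forall w, `|f w| <= b) -> (forall w, `|g w| <= b) ->
  (forall w, f w <= g w) -> Ex f <= Ex g.
Proof.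
move=> mf mg fb gb fg; apply: le_Rintegral => //.
- exact: integrable_bounded fb.
- exact: integrable_bounded gb.
Qed.

(** Under an expectation, [bspl (Z w)] becomes a weighted average over u of [cos (u * Z w)].
    Integrability in u belongs to the conclusion because the integrands are compared later. *)
Lemma bker_Fubini H Z : measurable_fun setT H -> measurable_fun setT Z ->
  (forall w, `|H w| <= 1) ->
  mu.-integrable setT (EFin \o (fun u => bker u * Ex (fun w => H w * cos (u * Z w)))) /\
  Rintegral mu setT (fun u => bker u * Ex (fun w => H w * cos (u * Z w))) =
  bker_mass * Ex (fun w => H w * bspl (Z w)).
Proof.
move=> mH mZ H1.
pose f (z : Omega * measurableTypeR R) : \bar R := (H z.1 * (bker z.2 * cos (z.2 * Z z.1)))%:E.
have m1 (g : Omega -> R) : measurable_fun setT g ->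
    measurable_fun [set: Omega * measurableTypeR R] (fun z => g z.1).
  by move=> mg; exact: measurableT_comp mg measurable_fst.
have m2 (g : R -> R) : measurable_fun setT g ->
    measurable_fun [set: Omega * measurableTypeR R] (fun z => g z.2).
  by move=> mg; exact: measurableT_comp mg measurable_snd.
have mf : measurable_fun setT f.
  apply/measurable_EFinP; apply: measurable_funM; first exact: m1.
  apply: measurable_funM; first exact: (m2 _ measurable_bker).
  apply: measurableT_comp measurable_cos _.
  by apply: measurable_funM; [exact: (m2 id)|exact: m1].
have cosb x : `|cos x| <= 1 :> R.
  by rewrite ler_norml cos_geN1 cos_le1.
have fb w u : `|H w * (bker u * cos (u * Z w))| <= bker u.
  rewrite 2!normrM (ger0_norm (bker_ge0 u)) mulrCA -[leRHS]mulr1.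
  by apply: ler_wpM2l; [exact: bker_ge0|apply: mulr_ile1].
have mcw w : measurable_fun [set: R] (fun u : R => cos (u * Z w)).
  apply: measurableT_comp measurable_cos _; exact: measurable_funM.
have mHc u : measurable_fun [set: Omega] (fun w => H w * cos (u * Z w)).
  apply: measurable_funM => //.
  apply: measurableT_comp measurable_cos _; exact: measurable_funM.
have iHc u : P.-integrable setT (EFin \o (fun w => H w * cos (u * Z w))).
  apply: (@integrable_bounded _ 1) => // w.
  by rewrite normrM; apply: mulr_ile1.
have icw w : mu.-integrable setT (EFin \o (fun u => bker u * cos (u * Z w))).
  by apply: integrable_bkerM => // u; rewrite (le_trans (cosb _))// lerDl sqr_ge0.
(* The integrand is dominated by [bker u], and [P] has mass 1, so the iterated integral is at most
   the mass of the weight. *)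
have fi : (P \x mu)%E.-integrable setT f.
  apply/(integrable21ltyP P mu mf).
  apply: (@le_lt_trans _ _ (\int[mu]_u (bker u)%:E)%E); last first.
    exact: (integral_fune_lt_pinfty measurableT integrable_bker).
  apply: ge0_le_integral => //.
  - by move=> u _; apply: integral_ge0.
  - have mf' : measurable_fun setT (fun z => `|f z|%E) by exact: measurableT_comp.
    exact: (@measurable_fun_fubini_tonelli_G _ _ _ _ _ P _ mf' (fun x => abse_ge0 _)).
  - by apply/measurable_EFinP; exact: measurable_bker.
  - move=> u _; have <- : (\int[P]_(w in setT) (bker u)%:E = (bker u)%:E)%E.
      have e : (P : {measure set Omega -> \bar R}) setT = 1%E := probability_setT P.
      by rewrite integral_cst// e mule1.
    apply: ge0_le_integral => //.
    + by apply: measurableT_comp => //; exact: measurableT_comp mf (measurable_pair2 _).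
    + by move=> w _; rewrite /f /= lee_fin fb.
have F :  ((\int[P]_x \int[mu]_y f (x, y)) =
    (\int[P]_w (bker_mass * (H w * bspl (Z w)))%:E))%E.
  apply: eq_integral => w _; rewrite /f/=.
  under eq_integral do rewrite EFinM.
  rewrite integralZl//; last exact: icw.
  rewrite -(fineK (integrable_fin_num measurableT (icw w))) -EFinM; congr EFin.
  by rewrite -/(Rintegral mu setT _) bspl_fourier; ring.
have fE u : (\int[P]_x f (x, u) = (bker u * Ex (fun w => H w * cos (u * Z w)))%:E)%E.
  rewrite /f/=; under eq_integral do rewrite mulrCA EFinM.
  rewrite integralZl//; last exact: iHc.
  by rewrite -(fineK (integrable_fin_num measurableT (iHc u))) -EFinM.
have gi : mu.-integrable setT
    (EFin \o (fun u => bker u * Ex (fun w => H w * cos (u * Z w)))).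
  apply: (le_integrable measurableT) integrable_bker => //.
    have -> : EFin \o (fun u => bker u * Ex (fun w => H w * cos (u * Z w))) = fubini_G P f.
      by apply/funext => v; rewrite /= -fE.
    exact: measurable_fubini_G fi.
  move=> u _ /=; rewrite lee_fin normrM ler_piMr//.
  have Hc w : `|H w * cos (u * Z w)| <= 1 by rewrite normrM; apply: mulr_ile1.
  rewrite ler_norml -[leLHS]Ex_cst -[X in _ <= _ <= X]Ex_cst.
  apply/andP; split; apply: (@le_Ex _ _ 1) => // w; rewrite ?normrN ?normr1//;
    by have := Hc w; rewrite ler_norml => /andP[].
split => //.
transitivity (Ex (fun w => bker_mass * (H w * bspl (Z w)))).
  rewrite /Rintegral -F (Fubini fi); congr fine.
  by apply: eq_integral => u _; rewrite -fE.
rewrite RintegralZl//.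
apply: (@integrable_bounded _ 1).
  by apply: measurable_funM => //; exact: measurableT_comp measurable_bspl _.
by move=> w; rewrite normrM mulr_ile1// ger0_norm ?bspl_ge0 ?bspl_le1.
Qed.

End bounded_expectation.

(** * Exponents of linear combinations and the product inequality *)

Section stable_span.
Context d (Omega : measurableType d) (R : realType) (P : probability Omega R).
Context (T : Type) (X : T -> Omega -> R) (alpha : R).
Hypotheses (alpha_gt0 : 0 < alpha) (SaSX : SaS_process P alpha X).
Local Notation mu := (@lebesgue_measure R).
Local Notation Ex f := (Rintegral P setT f).
Implicit Types (u : R) (v z : seq (R * T)) (l : seq (seq (R * T))).

(** Finite linear combinations are coded by lists of coefficients and indices, so that addition is
    concatenation and no index set is fixed in advance. *)
Definition lincomb v (w : Omega) : R := \sum_(p <- v) p.1 * X p.2 w.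
Definition scalev u v : seq (R * T) := [seq (u * p.1, p.2) | p <- v].
(** The alpha-th power of the scale parameter, read off from the characteristic function at 1, so
    that no scale has to be chosen. *)
Definition cexponent v : R := - ln (Ex (fun w => cos (lincomb v w))).

Lemma lin_nil w : lincomb [::] w = 0.
Proof. by rewrite /lincomb big_nil. Qed.

Lemma lin_cat v z w : lincomb (v ++ z) w = lincomb v w + lincomb z w.
Proof. by rewrite /lincomb big_cat. Qed.

Lemma lin_scale u v w : lincomb (scalev u v) w = u * lincomb v w.
Proof. by rewrite /lincomb big_map big_distrr/=; apply: eq_bigr => p _; rewrite mulrA. Qed.

Lemma measurable_lin v : measurable_fun setT (lincomb v).
Proof.
apply: measurable_sum => p; apply: measurable_funM => //; exact: SaSX.1.
Qed.

Lemma measurable_cos_lin v : measurable_fun setT (fun w => cos (lincomb v w)).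
Proof. exact: measurableT_comp measurable_cos (measurable_lin v). Qed.

Lemma normr_cos_le1 (x : R) : `|cos x| <= 1.
Proof. by rewrite ler_norml cos_geN1 cos_le1. Qed.

Lemma cexponentP v : 0 <= cexponent v /\
  forall u, Ex (fun w => cos (u * lincomb v w)) = expR (- (cexponent v * `|u| `^ alpha)).
Proof.
have [c [c0 cP]] := SaSX.2 _ (fun i => (tnth (in_tuple v) i).2)
  (fun i => (tnth (in_tuple v) i).1).
have E u : Ex (fun w => cos (u * lincomb v w)) = expR (- (c `^ alpha * `|u| `^ alpha)).
  rewrite -powRM// -[RHS]/(fine (expR _)%:E) -(cP u).1 /Rintegral; congr fine.
  by apply: eq_integral => w _; rewrite /lincomb big_tnth.
have -> : cexponent v = c `^ alpha.
  rewrite /cexponent -[X in ln X]/(Ex _).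
  rewrite (_ : Ex _ = expR (- (c `^ alpha * `|1| `^ alpha))); last first.
    by rewrite -E; apply: eq_Rintegral => w _; rewrite mul1r.
  by rewrite expRK normr1 powR1 mulr1 opprK.
by split; [exact: powR_ge0|].
Qed.

Lemma cexponent_ge0 v : 0 <= cexponent v. Proof. by have [] := cexponentP v. Qed.

Lemma Ex_cos_lin u v :
  Ex (fun w => cos (u * lincomb v w)) = expR (- (cexponent v * `|u| `^ alpha)).
Proof. by have [] := cexponentP v. Qed.

Lemma cexponent_nil : cexponent [::] = 0.
Proof.
rewrite /cexponent (_ : Ex _ = 1) ?ln1 ?oppr0// -[RHS](Ex_cst P).
by apply: eq_Rintegral => w _; rewrite lin_nil cos0.
Qed.

Lemma cexponent_scale u v : cexponent (scalev u v) = cexponent v * `|u| `^ alpha.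
Proof.
rewrite {1}/cexponent (_ : Ex _ = Ex (fun w => cos (u * lincomb v w))).
  by rewrite Ex_cos_lin expRK opprK.
by apply: eq_Rintegral => w _; rewrite lin_scale.
Qed.

(** From exp(-x) <= 1 / (1 + x) and (1 + x) (1 - x + x^2) = 1 + x^3 >= 1. *)
Lemma expRN_le (x : R) : 0 <= x -> expR (- x) <= 1 - x + x ^+ 2.
Proof.
move=> x0; rewrite expRN; have h := expR_ge1Dx x.
apply: (@le_trans _ _ (1 + x)^-1).
  by rewrite lef_pV2 ?posrE ?expR_gt0//; lra.
rewrite -[leLHS]mul1r ler_pdivrMr; last by lra.
by nra.
Qed.

(* The first-order term at [s = 0] of an inequality between exponentials. *)
Lemma expR_germ (a b c e : R) : 0 <= c -> 0 <= e ->
  (forall s, 0 < s -> 0 <= 1 - expR (- (a * s)) - expR (- (b * s))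
     + (expR (- (c * s)) + expR (- (e * s))) / 2) ->
  c + e <= 2 * (a + b).
Proof.
move=> c0 e0 h; rewrite leNgt; apply/negP => abce.
pose D := c + e - 2 * (a + b).
have D0 : 0 < D by rewrite subr_gt0.
(* [K] bounds the second-order terms, and [s] is such that K s^2 = D s / 2, too small to make up for
   the first-order gap D s. *)
pose K := c ^+ 2 + e ^+ 2 + 1.
have K0 : 0 < K by rewrite ltr_wpDl// addr_ge0// sqr_ge0.
pose s := D / (2 * K).
have s0 : 0 < s by rewrite divr_gt0// mulr_gt0.
have := h s s0.
have := expR_ge1Dx (- (a * s)); have := expR_ge1Dx (- (b * s)).
have := expRN_le (mulr_ge0 c0 (ltW s0)); have := expRN_le (mulr_ge0 e0 (ltW s0)).
have KD : 2 * (K * s) = D by rewrite /s; field; rewrite gt_eqF.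
have KDs : 2 * (K * s ^+ 2) = D * s by rewrite -KD; ring.
have Ds : 0 < D * s by rewrite mulr_gt0.
have s2 : 0 < s ^+ 2 by rewrite exprn_gt0.
have : (c * s) ^+ 2 + (e * s) ^+ 2 = K * s ^+ 2 - s ^+ 2 by rewrite /K; ring.
have : D * s = c * s + e * s - 2 * (a * s) - 2 * (b * s) by rewrite /D; ring.
lra.
Qed.

(** With Y and Z the two combinations, the product-to-sum expansion of E (1 - cos tY) (1 - cos tZ)
    >= 0 is the hypothesis of [expR_germ] at s = t^alpha. *)
Lemma cexponent_parallelogram v z :
  cexponent (v ++ z) + cexponent (v ++ scalev (-1) z) <= 2 * (cexponent v + cexponent z).
Proof.
apply: expR_germ; try exact: cexponent_ge0.
move=> s s0; pose t := s `^ alpha^-1.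
have t0 : 0 <= t by exact: powR_ge0.
have ts : `|t| `^ alpha = s.
  by rewrite ger0_norm// -powRrM mulVf ?gt_eqF// powRr1// ltW.
rewrite -{1 2 3 4}ts -!Ex_cos_lin.
have ic x : P.-integrable setT (EFin \o (fun w => cos (t * lincomb x w))).
  apply: (@integrable_bounded _ _ _ _ _ 1) => [|w]; last exact: normr_cos_le1.
  apply: measurableT_comp measurable_cos _; apply: measurable_funM => //.
  exact: measurable_lin.
have i1 : P.-integrable setT (EFin \o (fun _ : Omega => 1 : R)).
  by apply: (@integrable_bounded _ _ _ _ _ 1) => // w; rewrite normr1.
have j1 := integrable_lincomb (1 / 2) (ic (v ++ scalev (- 1) z)) i1.
have j2 := integrable_lincomb (1 / 2) (ic (v ++ z)) j1.
have j3 := integrable_lincomb (- 1) (ic z) j2.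
have : 0 <= Ex (fun w => (1 - cos (t * lincomb v w)) * (1 - cos (t * lincomb z w))).
  by apply: Rintegral_ge0 => w _; rewrite mulr_ge0// subr_ge0 cos_le1.
rewrite (_ : Ex _ = Ex (fun w => -1 * cos (t * lincomb v w) +
    (-1 * cos (t * lincomb z w) + (1 / 2 * cos (t * lincomb (v ++ z) w) +
    (1 / 2 * cos (t * lincomb (v ++ scalev (-1) z) w) + 1))))).
  rewrite (Rintegral_lincomb _ (ic _) j3) (Rintegral_lincomb _ (ic _) j2).
  rewrite (Rintegral_lincomb _ (ic _) j1) (Rintegral_lincomb _ (ic _) i1) Ex_cst.
  by lra.
apply: eq_Rintegral => w _; rewrite !lin_cat lin_scale.
have -> : t * (lincomb v w + -1 * lincomb z w) = t * lincomb v w - t * lincomb z w.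
  by ring.
by rewrite (mulrDr t) cosB cosD; field.
Qed.

Lemma prod_abs_le1 (I : Type) (r : seq I) (F : I -> R) :
  (forall i, `|F i| <= 1) -> `|\prod_(i <- r) F i| <= 1.
Proof.
move=> F1; elim: r => [|i r IH]; first by rewrite big_nil normr1.
by rewrite big_cons normrM mulr_ile1.
Qed.

Lemma measurable_prod_lin l (g : R -> R) : measurable_fun setT g ->
  measurable_fun setT (fun w => \prod_(z <- l) g (lincomb z w)).
Proof.
move=> mg; elim: l => [|z l IH].
  by under eq_fun do rewrite big_nil; exact: measurable_cst.
under eq_fun do rewrite big_cons.
by apply: measurable_funM => //; exact: measurableT_comp mg (measurable_lin z).
Qed.

Lemma expR_mid (x y m : R) : 2 * m <= x + y -> expR m <= (expR x + expR y) / 2.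
Proof.
move=> h.
have t (a : R) : expR m * (1 + (a - m)) <= expR a.
  by rewrite -{2}[a](subrKC m) expRD ler_wpM2l ?expR_ge0// expR_ge1Dx.
have := t x; have := t y; have := expR_gt0 m.
move: (expR m) (expR x) (expR y) => M A B M0 hB hA; nra.
Qed.

Lemma integrable_cosM v (H : Omega -> R) : measurable_fun setT H ->
  (forall w, `|H w| <= 1) ->
  P.-integrable setT (EFin \o (fun w => cos (lincomb v w) * H w)).
Proof.
move=> mH H1; apply: (@integrable_bounded _ _ _ _ _ 1) => [|w].
  by apply: measurable_funM => //; exact: measurable_cos_lin.
by rewrite normrM mulr_ile1// normr_cos_le1.
Qed.

(** The first cosine is an accumulator: the product-to-sum formula merges [z] into [v] with either
    sign, the parallelogram inequality bounds the mean of the two exponents, and convexity of exp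
    passes to the mean of the exponentials. *)
Lemma Ex_prod_cos v l :
  expR (- (cexponent v + \sum_(z <- l) cexponent z)) <=
  Ex (fun w => cos (lincomb v w) * \prod_(z <- l) cos (lincomb z w)).
Proof.
elim: l v => [|z l IH] v.
  rewrite big_nil addr0; have := Ex_cos_lin 1 v; rewrite normr1 powR1 mulr1 => <-.
  apply: eq_ler; apply: eq_Rintegral => w _.
  by rewrite big_nil mulr1 mul1r.
pose H w := \prod_(x <- l) cos (lincomb x w).
have mH : measurable_fun setT H by exact: measurable_prod_lin measurable_cos.
have H1 w : `|H w| <= 1 by apply: prod_abs_le1 => x; exact: normr_cos_le1.
have i1 := integrable_cosM (v ++ z) mH H1.
have i2 := integrable_cosM (v ++ scalev (-1) z) mH H1.
rewrite (_ : Ex _ = Ex (fun w => 1 / 2 * (1 * (cos (lincomb (v ++ z) w) * H w) +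
    cos (lincomb (v ++ scalev (-1) z) w) * H w))); last first.
  apply: eq_Rintegral => w _; rewrite big_cons -/(H w) !lin_cat lin_scale mulN1r.
  by rewrite cosB cosD; field.
rewrite RintegralZl//; last exact: integrable_lincomb.
rewrite (Rintegral_lincomb _ i1 i2) !mul1r [leRHS]mulrC.
apply: (@le_trans _ _ ((expR (- (cexponent (v ++ z) + \sum_(x <- l) cexponent x)) +
   expR (- (cexponent (v ++ scalev (-1) z) + \sum_(x <- l) cexponent x))) / 2)).
  by apply: expR_mid; have := cexponent_parallelogram v z; rewrite big_cons; lra.
by rewrite ler_pM2r ?invr_gt0// lerD.
Qed.

(** By [bker_Fubini], this is the expectation of [bspl Z] for a symmetric stable Z with exponent
    [p]. *)
Definition sidak_factor (p : R) : R :=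
  Rintegral mu setT (fun u => bker u * expR (- (p * `|u| `^ alpha))) / bker_mass.

Lemma measurable_expR_powR (p : R) :
  measurable_fun [set: R] (fun u : R => expR (- (p * `|u| `^ alpha))).
Proof.
apply: measurableT_comp => //; apply: measurableT_comp => //.
apply: measurable_funM => //.
exact: measurableT_comp (measurable_powR _) (@normr_measurable R setT).
Qed.

Lemma expR_powR_le1 (p u : R) : 0 <= p -> 0 <= expR (- (p * `|u| `^ alpha)) <= 1.
Proof.
by move=> p0; rewrite expR_ge0/= -expR0 ler_expR oppr_le0 mulr_ge0// powR_ge0.
Qed.

Lemma integrable_bker_expR (p : R) : 0 <= p ->
  mu.-integrable setT (EFin \o (fun u => bker u * expR (- (p * `|u| `^ alpha)))).
Proof.
move=> p0; apply: integrable_bkerM; first exact: measurable_expR_powR.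
move=> u; have /andP[e0 e1] := expR_powR_le1 u p0.
by rewrite ger0_norm// (le_trans e1)// lerDl sqr_ge0.
Qed.

(* One factor [cos (lincomb z)] at a time is integrated against
   the Fourier weight of the spline. *)
Lemma Ex_prod_bspl_cos l1 l2 :
  \prod_(z <- l1) sidak_factor (cexponent z) * expR (- \sum_(z <- l2) cexponent z) <=
  Ex (fun w => \prod_(z <- l1) bspl (lincomb z w) * \prod_(z <- l2) cos (lincomb z w)).
Proof.
elim: l1 l2 => [|z l1 IH] l2.
  rewrite big_nil mul1r; have := Ex_prod_cos [::] l2; rewrite cexponent_nil add0r.
  move=> /le_trans; apply; apply: eq_ler.
  by apply: eq_Rintegral => w _; rewrite big_nil lin_nil cos0.
pose H w := \prod_(z <- l1) bspl (lincomb z w) * \prod_(z <- l2) cos (lincomb z w).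
have mH : measurable_fun setT H.
  apply: measurable_funM; first exact: measurable_prod_lin measurable_bspl.
  exact: measurable_prod_lin measurable_cos.
have H1 w : `|H w| <= 1.
  rewrite normrM mulr_ile1// prod_abs_le1// => x; last exact: normr_cos_le1.
  by rewrite ger0_norm ?bspl_ge0 ?bspl_le1.
have [gi gE] := bker_Fubini P mH (measurable_lin z) H1.
rewrite (_ : Ex _ = Ex (fun w => H w * bspl (lincomb z w))); last first.
  by apply: eq_Rintegral => w _; rewrite big_cons /H; ring.
rewrite -(ler_pM2l (bker_mass_gt0 (R := R))) -gE big_cons.
set c := \prod_(j <- l1) _; set e := expR _.
have pi := integrable_bker_expR (cexponent_ge0 z).
have -> : bker_mass * (sidak_factor (cexponent z) * c * e) = Rintegral mu setT
    (fun u => c * e * (bker u * expR (- (cexponent z * `|u| `^ alpha)))).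
  rewrite RintegralZl// /sidak_factor; move: (bker_mass_gt0 (R := R)) => W0.
  by field; rewrite gt_eqF.
apply: le_Rintegral => //.
  exact: (integrableZl measurableT (c * e) pi).
move=> u _; rewrite mulrCA; apply: ler_wpM2l; first exact: bker_ge0.
(* For fixed u, [cos (u * lincomb z w)] is the cosine of a scaled combination and joins the list of
   cosines. *)
have := IH (scalev u z :: l2); rewrite big_cons cexponent_scale opprD expRD.
rewrite -/c -/e => h; rewrite -mulrA (mulrC e); apply: (le_trans h).
apply: eq_ler; apply: eq_Rintegral => w _.
by rewrite big_cons lin_scale /H; ring.
Qed.

Lemma measurable_all_lin l : measurable [set w | all (fun z => `|lincomb z w| <= 2) l].
Proof.
elim: l => [|z l IH] /=.
  by rewrite (_ : [set w | true] = setT)//; apply/seteqP; split.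
rewrite (_ : mkset _ =
    [set w | `|lincomb z w| <= 2] `&` [set w | all (fun z => `|lincomb z w| <= 2) l]).
  apply: measurableI => //.
  have m2 : measurable_fun setT (fun w => `|lincomb z w| <= 2).
    apply: measurable_fun_ler => //.
    exact: measurableT_comp (@normr_measurable R setT) (measurable_lin z).
  by have := m2 measurableT [set true] I; rewrite setTI.
by apply/seteqP; split => w /=; move/andP.
Qed.

(** The product of the splines lies below the indicator of the event: it is at most 1, and it
    vanishes as soon as one combination exceeds 2 in absolute value. *)
Lemma sidak l : ((\prod_(z <- l) sidak_factor (cexponent z))%:E <=
  P [set w | all (fun z => `|lincomb z w| <= 2)%R l])%E.
Proof.
set A := [set w | _].
have mA : measurable A by exact: measurable_all_lin.
have cb w : `|\prod_(z <- l) bspl (lincomb z w)| <= 1.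
  by apply: prod_abs_le1 => z; rewrite ger0_norm ?bspl_ge0 ?bspl_le1.
have := Ex_prod_bspl_cos l [::]; rewrite big_nil oppr0 expR0 mulr1 => h.
have <- : (\int[P]_w (\1_A w)%:E = P A)%E by rewrite integral_indic// setIT.
have iB : P.-integrable setT (EFin \o (fun w => \prod_(z <- l) bspl (lincomb z w))).
  by apply: integrable_bounded cb; exact: measurable_prod_lin measurable_bspl.
apply: (@le_trans _ _ (Ex (fun w => \prod_(z <- l) bspl (lincomb z w)))%:E).
  rewrite lee_fin (le_trans h)//; apply: eq_ler.
  by apply: eq_Rintegral => w _; rewrite big_nil mulr1.
rewrite /Rintegral (fineK (integrable_fin_num measurableT iB)).
apply: ge0_le_integral => //.
- by move=> w _; rewrite lee_fin prodr_ge0// => z _; exact: bspl_ge0.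
- by apply/measurable_EFinP; exact: measurable_prod_lin measurable_bspl.
- by apply/measurable_EFinP; exact: measurable_indic.
move=> w _; rewrite lee_fin indicE; have [wA|wA] := boolP (w \in A).
  by rewrite (le_trans (ler_norm _))// cb.
rewrite -[leRHS]/(0 : R) le_eqVlt; apply/orP; left.
have {wA} : ~~ all (fun z => `|lincomb z w| <= 2) l.
  by apply: contra wA => wA; rewrite inE.
elim: (l) => // z r IH /=; rewrite big_cons negb_and -ltNge => /orP[/ltW|/IH/eqP ->].
  by move/bspl_eq0 ->; rewrite mul0r.
by rewrite mulr0.
Qed.

End stable_span.

(** * Chaining *)

Section sidak_factor_bounds.
Context {R : realType}.
Local Notation mu := (@lebesgue_measure R).
Implicit Types (alpha p c u : R).

Lemma one_powR alpha : 1 `^ alpha = 1 :> R.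
Proof. by rewrite powR1. Qed.

(** Here alpha < 2 enters: the finite second moment of the weight controls the alpha-th one. *)
Lemma powR_le_1Dsqr alpha u : 0 < alpha -> alpha < 2 -> `|u| `^ alpha <= 1 + u ^+ 2.
Proof.
move=> a0 a2; have [u1|u1] := leP 1 `|u|.
  rewrite (le_trans (ler_powR u1 (ltW a2)))//.
  by rewrite (powR_mulrn 2)// -normrX ger0_norm ?sqr_ge0// lerDr.
rewrite (@le_trans _ _ 1)//; last by rewrite lerDl sqr_ge0.
rewrite -[leRHS](one_powR alpha); apply: ge0_ler_powR; rewrite ?nnegrE// ltW//.
Qed.

(** The mean of 1 + u^2 under the weight normalised to a probability density. *)
Definition bker_moment : R :=
  Rintegral mu setT (fun u => bker u * (1 + u ^+ 2)) / bker_mass.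

Lemma measurable_1Dsqr : measurable_fun [set: R] (fun u : R => 1 + u ^+ 2).
Proof. by apply: measurable_funD => //; exact: measurable_funX. Qed.

Lemma integrable_bker_1Dsqr :
  mu.-integrable setT (EFin \o (fun u => bker u * (1 + u ^+ 2))).
Proof.
apply: integrable_bkerM; first exact: measurable_1Dsqr.
by move=> u; rewrite ger0_norm// addr_ge0// sqr_ge0.
Qed.

Lemma bker_moment_ge0 : 0 <= bker_moment.
Proof.
apply: divr_ge0; last exact: ltW bker_mass_gt0.
by apply: Rintegral_ge0 => u _; rewrite mulr_ge0 ?bker_ge0// addr_ge0// sqr_ge0.
Qed.

(* Jensen's inequality, through the tangent line of the exponential at the mean. *)
Lemma sidak_factor_ge_expR alpha p : 0 < alpha -> alpha < 2 -> 0 <= p ->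
  expR (- (bker_moment * p)) <= sidak_factor alpha p.
Proof.
move=> a0 a2 p0; rewrite /sidak_factor ler_pdivlMr ?bker_mass_gt0//.
set M := bker_moment; set e := expR _.
have e0 : 0 < e by exact: expR_gt0.
have ib := integrable_bker (R := R).
have i1 := integrable_bker_1Dsqr.
(* The tangent line integrates to exactly [e * bker_mass], because [M] is the mean of 1 + u^2. *)
apply: (@le_trans _ _ (Rintegral mu setT
  (fun u => - (e * p) * (bker u * (1 + u ^+ 2))
   + e * (1 + M * p) * bker u))).
  rewrite (Rintegral_lincomb _ i1); last exact: (integrableZl measurableT _ ib).
  rewrite RintegralZl// -/bker_mass.
  have -> : Rintegral mu setT (fun u => bker u * (1 + u ^+ 2)) = M * bker_mass.
    by rewrite /M /bker_moment divfK// gt_eqF// bker_mass_gt0.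
  by apply: eq_ler; ring.
apply: le_Rintegral => //.
- apply: (integrable_lincomb _ i1); exact: (integrableZl measurableT _ ib).
- exact: integrable_bker_expR.
move=> u _; rewrite mulrCA (mulrC (e * _) (bker u)) -mulrDr.
apply: ler_wpM2l; first exact: bker_ge0.
apply: (@le_trans _ _ (expR (- (p * (1 + u ^+ 2))))); last first.
  by rewrite ler_expR lerN2 ler_wpM2l// powR_le_1Dsqr.
have -> : - (p * (1 + u ^+ 2)) = - (M * p) + (M * p - p * (1 + u ^+ 2)) by ring.
rewrite expRD -/e; apply: (@le_trans _ _ (e * (1 + (M * p - p * (1 + u ^+ 2))))).
  by apply: eq_ler; ring.
by apply: ler_wpM2l; [exact: ltW|exact: expR_ge1Dx].
Qed.

(** For 0 < u <= 1 / c the exponent p u^alpha is at most 1, so this interval alone contributes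
    exp(-1) / (8 c) to the integral, uniformly in alpha. *)
Lemma sidak_factor_ge_inv : exists2 kappa : R, 0 < kappa &
  forall alpha c p, 0 < alpha -> 1 <= c -> 0 <= p -> p <= c `^ alpha ->
    kappa / c <= sidak_factor alpha p.
Proof.
exists (expR (- 1) / (8 * bker_mass)).
  by rewrite divr_gt0 ?expR_gt0// mulr_gt0// bker_mass_gt0.
move=> alpha c p a0 c1 p0 pc; have c0 : 0 < c by apply: lt_le_trans c1.
rewrite /sidak_factor invfM mulrA mulrAC ler_pM2r ?invr_gt0 ?bker_mass_gt0//.
apply: (@le_trans _ _ (c^-1 / 8 * expR (- 1))).
  by apply: eq_ler; ring.
apply: bker_mass_ge.
- by rewrite invr_ge0 ltW.
- by rewrite invf_le1.
- exact: measurable_expR_powR.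
- by move=> u; exact: expR_powR_le1.
- exact: expR_ge0.
move=> u u0 uc; rewrite ler_expR lerN2 (ger0_norm (ltW u0)).
apply: (@le_trans _ _ (c `^ alpha * u `^ alpha)).
  by rewrite ler_wpM2r// powR_ge0.
have c0' := ltW c0; have u0' := ltW u0.
rewrite -powRM// -[leRHS](one_powR alpha).
apply: ge0_ler_powR; rewrite ?nnegrE ?mulr_ge0//; first exact: ltW.
by rewrite mulrC -ler_pdivlMr// mul1r.
Qed.

End sidak_factor_bounds.

(** * One step of the chaining *)

Section chaining.
Context d (Omega : measurableType d) (R : realType) (P : probability Omega R).
Context (T : Type) (X : T -> Omega -> R) (alpha : R) (rho : T -> T -> R).
Hypothesis alpha_gt0 : 0 < alpha.
Hypothesis scaleX : forall s t, SaS_scale P alpha (fun w => X t w - X s w) (rho s t).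
Local Notation lin := (lincomb X).
Local Notation cexp := (cexponent P X).
Local Notation gain := (sidak_factor alpha).

(** The coefficient 2 / a matches the threshold 2 of [sidak] with the tolerance [a] for the
    increment. *)
Definition incr (a : R) (s t : T) : seq (R * T) := [:: (2 / a, t); (- (2 / a), s)].

Lemma lin_incr a s t w : lin (incr a s t) w = 2 / a * (X t w - X s w).
Proof. by rewrite /lincomb /incr big_cons big_seq1 /=; ring. Qed.

Lemma rho_ge0 s t : 0 <= rho s t. Proof. by have [] := scaleX s t. Qed.

Lemma cexponent_incr a s t : 0 < a -> cexp (incr a s t) = (rho s t * (2 / a)) `^ alpha.
Proof.
move=> a0; have [r0 h] := scaleX s t; have [h1 _] := h (2 / a).
rewrite /cexponent (_ : Rintegral _ _ _ = expR (- ((rho s t * (2 / a)) `^ alpha))).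
  by rewrite expRK opprK.
rewrite -(ger0_norm (_ : 0 <= 2 / a)) ?divr_ge0 ?ltW//.
rewrite -[RHS]/(fine (expR _)%:E) -h1 /Rintegral; congr fine.
by apply: eq_integral => w _; rewrite lin_incr.
Qed.

Definition controls (l : seq (seq (R * T))) (r s : T) (b : R) :=
  forall w, all (fun z => `|lin z w| <= 2) l -> `|X s w - X r w| <= b.

(** State of the chaining at radius [delta], with accumulated tolerance [b] and probability bound
    [q]. The constraints are kept as a list, and control is pathwise, so that [sidak] is applied
    only once, to the whole chain. *)
Definition stage (r : T) (delta b q : R) :=
  exists (n : nat) (g : 'I_n -> T) (l : seq (seq (R * T))),
    [/\ forall t, exists i, rho t (g i) <= delta,
        forall i, controls l r (g i) b &
        q <= \prod_(z <- l) gain (cexp z)].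

(** Each new point is linked by one increment of tolerance [a] to an old net point within [delta];
    the exponent is at most (2 delta / a)^alpha, so the link costs a factor exp(-kappa). The new
    points are arbitrary, which serves for the last link. *)
Lemma stage_extend r delta b q n (g : 'I_n -> T) a kappa :
  stage r delta b q -> 0 <= q -> 0 < a ->
  (forall p, 0 <= p -> p <= (delta * (2 / a)) `^ alpha -> expR (- kappa) <= gain p) ->
  exists l, (forall i, controls l r (g i) (b + a)) /\
    q * expR (- (n%:R * kappa)) <= \prod_(z <- l) gain (cexp z).
Proof.
move=> [m [f [l [fcov fl ql]]]] q0 a0 hk.
have [h hP] := choice (fun i => fcov (g i)).
have a2 : 0 <= 2 / a by rewrite divr_ge0// ltW.
exists (l ++ [seq incr a (g i) (f (h i)) | i <- enum 'I_n]); split.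
  move=> i w; rewrite all_cat all_map => /andP[lw /allP/(_ i)].
  rewrite mem_enum => /(_ isT)/=; rewrite lin_incr => h2.
  have {}h2 : `|X (f (h i)) w - X (g i) w| <= a.
    move: h2; rewrite normrM (ger0_norm a2) => h2.
    have : 2 * `|X (f (h i)) w - X (g i) w| <= 2 * a.
      by rewrite -ler_pdivrMr// mulrAC.
    by rewrite ler_pM2l.
  rewrite -(subrKA (X (f (h i)) w)) addrC (le_trans (ler_normD _ _))// lerD//.
    exact: fl.
  by rewrite distrC.
rewrite big_cat/= big_map; apply: ler_pM => //.
rewrite big_enum/= -mulrN -[X in expR (X%:R * _)]card_ord expRM_natl.
rewrite -prodr_const; apply: ler_prod => i _; rewrite expR_ge0/=.
rewrite cexponent_incr//; apply: hk; first exact: powR_ge0.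
apply: ge0_ler_powR; rewrite ?nnegrE.
- exact: ltW.
- by rewrite mulr_ge0 ?rho_ge0.
- by rewrite mulr_ge0// (le_trans (rho_ge0 _ _) (hP i)).
- by rewrite ler_wpM2r.
Qed.

Lemma stage_next r delta b q n (g : 'I_n -> T) a kappa delta' :
  stage r delta b q -> 0 <= q -> 0 < a ->
  (forall p, 0 <= p -> p <= (delta * (2 / a)) `^ alpha -> expR (- kappa) <= gain p) ->
  (forall t, exists i, rho t (g i) <= delta') ->
  stage r delta' (b + a) (q * expR (- (n%:R * kappa))).
Proof.
move=> st q0 a0 hk gcov; have [l [gl ql]] := stage_extend g st q0 a0 hk.
by exists n, g, l.
Qed.

End chaining.

(** * From finite families to the whole process *)

Section separability.
Context d (Omega : measurableType d) (R : realType) (P : probability Omega R).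
Context (T : Type) (X : T -> Omega -> R) (rho : T -> T -> R).

Lemma countable_enum (S : set T) (r : T) : countable S ->
  exists e : nat -> T, S `<=` range e.
Proof.
move=> /pfcard_geP[->|[f]]; first by exists (fun=> r).
by exists f; exact: surj.
Qed.

Lemma measurable_normB_le (mX : forall t, measurable_fun setT (X t)) s r (b : R) :
  measurable [set w | `|X s w - X r w| <= b].
Proof.
have m2 : measurable_fun setT (fun w => `|X s w - X r w| <= b).
  apply: measurable_fun_ler => //.
  apply: measurableT_comp (@normr_measurable R setT) _.
  exact: measurable_funB.
by have := m2 measurableT [set true] I; rewrite setTI.
Qed.

(** Continuity from above along an enumeration of the separating set gives the bound there;
    separability extends it to all of T off a null set, and passing through [r] doubles [b]. The
    measurable set [A] stands in for an event over a possibly uncountable T. *)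
Lemma separable_small_ball (r : T) (b q : R) :
  (forall t, measurable_fun setT (X t)) -> separable_process P rho X ->
  (forall n (g : 'I_n -> T),
    (q%:E <= P [set w | forall i, (`|X (g i) w - X r w| <= b)%R])%E) ->
  exists A : set Omega, measurable A /\
    A `<=` [set w | forall s t, `|X s w - X t w| <= 2 * b] /\ (q%:E <= P A)%E.
Proof.
move=> mX [S [cS [N [mN [PN0 sepN]]]]] hq.
have [e Se] := countable_enum r cS.
pose E n := [set w | forall i : 'I_n, `|X (e i) w - X r w| <= b].
have mE n : measurable (E n).
  rewrite (_ : E n = \bigcap_(i in [set: 'I_n]) [set w | `|X (e i) w - X r w| <= b]).
    by apply: fin_bigcap_measurable => // i _; exact: measurable_normB_le.
  by apply/seteqP; split => w /= h i => [_|]; exact: h.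
have mB : measurable (\bigcap_n E n) by exact: bigcapT_measurable.
have nE : nonincreasing_seq E.
  move=> m n mn; apply/subsetPset => w h i; exact: (h (widen_ord mn i)).
have qB : (q%:E <= P (\bigcap_n E n))%E.
  have cv := nonincreasing_cvg_mu (mu := P) _ mE mB nE.
  have {}cv := cv (le_lt_trans (probability_le1 P (mE 0%N)) (ltry _)).
  rewrite -(cvg_lim _ cv)//; apply: lime_ge; first by apply/cvg_ex; eexists; exact: cv.
  by apply: nearW => n; exact: hq.
exists (\bigcap_n E n `\` N); split; first exact: measurableD.
split.
  move=> w [Ew Nw] s t /=.
  have close t' : `|X t' w - X r w| <= b.
    have [u [Su [_ cu]]] := sepN w Nw t'.
    have cu' : (fun k => `|X (u k) w - X r w|) @ \oo --> `|X t' w - X r w|.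
      by apply: cvg_norm; apply: cvgB => //; exact: cvg_cst.
    rewrite -(cvg_lim _ cu')//; apply: limr_le; first by apply/cvg_ex; eexists; exact: cu'.
    apply: nearW => k; have [i _ <-] := Se _ (Su k).
    (* [E i.+1] is the first event that constrains the point [e i]. *)
    exact: (Ew i.+1 I ord_max).
  rewrite -(subrKA (X r w)) (le_trans (ler_normD _ _))//.
  by rewrite mulr_natl mulr2n lerD// distrC.
apply: (le_trans qB); rewrite -[leRHS]adde0 -PN0.
apply: (@le_trans _ _ (P ((\bigcap_n E n `\` N) `|` N))).
  apply: le_measure; rewrite ?inE//; first by apply: measurableU => //; exact: measurableD.
  by move=> w Ew; have [Nw|Nw] := pselect (N w); [right|left].
exact: measureU2 (measurableD mB mN) mN.
Qed.

End separability.

(** * The tolerance profile and its dyadic sums *)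

Section Psi_hat_sum.
Context {R : realType} (alpha : R) (Psi : R -> R).
Hypothesis alpha_gt0 : 0 < alpha.
Hypothesis Psi_ge1 : forall x : R, 0 < x -> 1 <= Psi x.
Hypothesis Psi_noninc : forall x y : R, 0 < x -> x <= y -> Psi y <= Psi x.
Hypothesis Psi_cont : forall x : R, 0 < x -> {for x, continuous Psi}.
Local Notation mu := (@lebesgue_measure R).

(** The profile theta of the fine chaining: the tolerance at radius x up to a factor common to all
    levels. It equals x times the integrand of [Psi_hat]. *)
Definition Psi_term (x : R) : R := (Psi x * x `^ alpha) `^ (1 / (alpha + 1)).
Definition Psi_root (u : R) : R := (Psi u / u) `^ (1 / (alpha + 1)).

Lemma alphaD1_gt0 : 0 < alpha + 1. Proof. by rewrite addr_gt0. Qed.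

Lemma Psi_gt0 x : 0 < x -> 0 < Psi x.
Proof. by move=> /Psi_ge1; apply: lt_le_trans. Qed.

Lemma Psi_term_gt0 x : 0 < x -> 0 < Psi_term x.
Proof. by move=> x0; rewrite powR_gt0// mulr_gt0 ?powR_gt0// Psi_gt0. Qed.

Lemma Psi_term_powR x : 0 < x -> Psi_term x `^ (alpha + 1) = Psi x * x `^ alpha.
Proof.
move=> x0; rewrite /Psi_term -powRrM mul1r mulVf ?gt_eqF ?alphaD1_gt0// powRr1//.
by rewrite mulr_ge0 ?powR_ge0// ltW// Psi_gt0.
Qed.

Lemma Psi_termE x : 0 < x -> Psi_term x = x * Psi_root x.
Proof.
move=> x0; have x0' := ltW x0; have p0 := ltW (Psi_gt0 x0).
have e : Psi x * x `^ alpha = x `^ (alpha + 1) * (Psi x / x).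
  rewrite powRD; last by rewrite (gt_eqF x0) implybT.
  by rewrite powRr1//; field; rewrite gt_eqF.
rewrite /Psi_term e powRM ?powR_ge0 ?divr_ge0// -powRrM mul1r divff ?powRr1//.
  by rewrite /Psi_root mul1r.
by rewrite gt_eqF// alphaD1_gt0.
Qed.

Lemma measurable_Psi_root (e : R) : measurable_fun (`]0, e]%classic : set R) Psi_root.
Proof.
have m : measurable_fun (`]0, +oo[%classic : set R) Psi_root.
  apply: (measurableT_comp (measurable_powR _)).
  apply: open_continuous_measurable_fun; first exact: interval_open.
  move=> x; rewrite inE/= in_itv/= andbT => x0.
  apply: cvgM; first exact: Psi_cont.
  by apply: inv_continuous; rewrite gt_eqF.
apply: measurable_funS m => // x /=.
by rewrite !in_itv/= => /andP[->].
Qed.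

Lemma Psi_root_ge0 x : 0 <= Psi_root x. Proof. exact: powR_ge0. Qed.

(** The integrand is non-increasing and the interval has length x / 2. *)
Lemma Psi_root_int_ge (x : R) : 0 < x ->
  ((Psi_term x / 2)%:E <= \int[mu]_(u in `](x / 2)%R, x]) (Psi_root u)%:E)%E.
Proof.
move=> x0; have x2 : 0 < x / 2 by rewrite divr_gt0.
have x2x : x / 2 < x by lra.
apply: (@le_trans _ _ (\int[mu]_(u in `](x / 2)%R, x]) (Psi_root x)%:E)%E).
  rewrite integral_cst//= lebesgue_measure_itv/= lte_fin x2x -EFinB -EFinM lee_fin.
  by rewrite Psi_termE//; apply: eq_ler; field.
apply: ge0_le_integral => //.
- by move=> u _; rewrite lee_fin Psi_root_ge0.
- apply/measurable_EFinP; have m := @measurable_Psi_root x.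
  apply: (measurable_funS _ _ m) => //.
  by move=> u /=; rewrite !in_itv/= => /andP[xu ->]; rewrite (lt_trans x2 xu).
move=> u /=; rewrite in_itv/= => /andP[xu ux]; rewrite lee_fin.
have u0 : 0 < u by exact: lt_trans xu.
apply: ge0_ler_powR.
- by rewrite divr_ge0// ltW// alphaD1_gt0.
- by rewrite nnegrE divr_ge0// ltW// Psi_gt0.
- by rewrite nnegrE divr_ge0// ltW// Psi_gt0.
apply: ler_pM; rewrite ?invr_ge0 ?(ltW (Psi_gt0 x0)) ?(ltW x0)//.
  exact: Psi_noninc.
by rewrite lef_pV2.
Qed.

Lemma sum_Psi_term_le (e h : R) n : 0 < e -> Psi_hat alpha Psi e = h%:E ->
  \sum_(k < n) Psi_term (e / 2 ^+ k) <= 2 * h.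
Proof.
move=> e0 hE.
have ek k : 0 < e / 2 ^+ k by rewrite divr_gt0// exprn_gt0.
(* The integral over the interval not yet used is kept, so that the induction peels off one dyadic
   piece at a time. *)
have H : ((\sum_(k < n) (Psi_term (e / 2 ^+ k) / 2))%:E +
    \int[mu]_(u in `]0%R, (e / 2 ^+ n)%R]) (Psi_root u)%:E <= h%:E)%E.
  elim: n => [|n IH].
    by rewrite big_ord0 add0e expr0 divr1 -hE /Psi_hat.
  apply: le_trans IH; rewrite big_ord_recr/= EFinD -addeA leeD2lE//.
  have e2 : e / 2 ^+ n.+1 = e / 2 ^+ n / 2 by rewrite exprSr invfM mulrA.
  have e2l : e / 2 ^+ n / 2 < e / 2 ^+ n by have := ek n; lra.
  rewrite e2 addeC; apply: (@le_trans _ _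
    (\int[mu]_(u in `]0%R, (e / 2 ^+ n / 2)%R]) (Psi_root u)%:E
    + \int[mu]_(u in `](e / 2 ^+ n / 2)%R, (e / 2 ^+ n)%R]) (Psi_root u)%:E)%E).
    by apply: leeD2l; exact: Psi_root_int_ge.
  have U : `]0, (e / 2 ^+ n / 2)] `|` `](e / 2 ^+ n / 2), (e / 2 ^+ n)] =
      `]0, (e / 2 ^+ n)]%classic :> set R.
    apply/seteqP; split => u /=; rewrite !in_itv/=.
      move=> [/andP[-> u1]|/andP[u1 ->]]; rewrite ?andbT/=.
        by rewrite (le_trans u1)// ltW.
      by apply: lt_trans u1; rewrite divr_gt0.
    by move=> /andP[-> ->]; have [u1|u1] := leP u (e / 2 ^+ n / 2); [left|right].
  rewrite -ge0_integral_setU// ?U//.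
  - apply/measurable_EFinP; exact: measurable_Psi_root.
  - by move=> u _; rewrite lee_fin Psi_root_ge0.
  - rewrite disj_set2E; apply/eqP/seteqP; split => // u /=.
    rewrite !in_itv/= => -[/andP[_ u1] /andP[u2 _]].
    by have := lt_le_trans u2 u1; rewrite ltxx.
have : ((\sum_(k < n) (Psi_term (e / 2 ^+ k) / 2))%:E <= h%:E)%E.
  apply: le_trans H; rewrite leeDl//; apply: integral_ge0 => u _.
  by rewrite lee_fin Psi_root_ge0.
by rewrite lee_fin -mulr_suml ler_pdivrMr// mulrC.
Qed.

End Psi_hat_sum.

(** * Numerical series and constants *)

Section constants.
Context {R : realType}.

Lemma sum_arith_geom_le (x : R) m : 0 <= x -> x < 1 ->
  \sum_(j < m) j.+1%:R * x ^+ j <= ((1 - x) ^+ 2)^-1.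
Proof.
move=> x0 x1; have x2 : 0 < (1 - x) ^+ 2 by rewrite exprn_gt0// subr_gt0.
rewrite -[leRHS]mul1r ler_pdivlMr//.
have -> : (\sum_(j < m) j.+1%:R * x ^+ j) * (1 - x) ^+ 2 =
    1 - x ^+ m * (1 + m%:R * (1 - x)).
  elim: m => [|m IH]; first by rewrite big_ord0 expr0; ring.
  by rewrite big_ord_recr/= mulrDl IH (exprS x) -natr1; ring.
rewrite gerBl mulr_ge0// ?exprn_ge0// addr_ge0// mulr_ge0// ltW// subr_gt0//.
Qed.

Lemma sum_half_le (e : R) m : 0 <= e -> \sum_(j < m) e / 2 ^+ j <= 2 * e.
Proof.
move=> e0; have -> : \sum_(j < m) e / 2 ^+ j = 2 * e - 2 * e / 2 ^+ m.
  elim: m => [|m IH]; first by rewrite big_ord0 expr0; field.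
  by rewrite big_ord_recr/= IH exprS; field; rewrite expf_neq0.
by rewrite gerBl divr_ge0 ?exprn_ge0 ?mulr_ge0.
Qed.

(** The factor is at least kappa / 4^(j + 1), so its cost is linear in j + 1. [L] is chosen before
    alpha, hence universal. *)
Lemma coarse_cost : exists2 L : R, 0 < L &
  forall alpha p j, 0 < alpha -> 0 <= p -> p <= (4 ^+ j.+1) `^ alpha ->
    expR (- (j.+1%:R * L)) <= sidak_factor alpha p.
Proof.
have [kappa k0 kP] := @sidak_factor_ge_inv R.
exists (ln 4 + `|ln kappa|); first by rewrite ltr_pwDl// ln_gt0// ltr1n.
move=> alpha p j a0 p0 pj.
have c1 : 1 <= 4 ^+ j.+1 :> R by rewrite exprn_ege1// ler1n.
apply: le_trans (kP _ _ _ a0 c1 p0 pj).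
have c0 : 0 < 4 ^+ j.+1 :> R by apply: lt_le_trans c1.
rewrite -[leRHS]lnK ?posrE ?divr_gt0// ler_expR ln_div ?posrE// lnXn//.
rewrite -[ln 4 *+ _]mulr_natl; have := ler_norm (- ln kappa); rewrite normrN => h.
have j1 : 1 <= j.+1%:R :> R by rewrite ler1n.
have : `|ln kappa| <= j.+1%:R * `|ln kappa| by rewrite ler_peMl.
by rewrite mulrDr; lra.
Qed.

Lemma half_pow_powR_le (alpha c : R) : 0 < alpha -> 0 <= c ->
  exists n, c * (2 / 2 ^+ n) `^ alpha <= 1.
Proof.
(* Since b^alpha = 1 / (c + 1), it suffices that 2 / 2^n <= b. *)
move=> a0 c0; pose b := (c + 1)^-1 `^ alpha^-1.
have c1 : 0 < (c + 1)^-1 by rewrite invr_gt0 ltr_wpDl.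
have b0 : 0 < b by exact: powR_gt0.
have [n nP] : exists n, 2 / b <= 2 ^+ n.
  exists (Num.truncn (2 / b)).+1; apply: ltW; apply: (lt_trans (truncnS_gt _)).
  by rewrite -natrX ltr_nat ltn_expl.
exists n; have n0 : 0 < 2 ^+ n :> R by rewrite exprn_gt0.
have h : 2 / 2 ^+ n <= b by rewrite ler_pdivrMr// mulrC -ler_pdivrMr.
apply: (@le_trans _ _ (c * b `^ alpha)).
  apply: ler_wpM2l => //; apply: ge0_ler_powR; rewrite ?nnegrE//; exact: ltW.
rewrite /b -powRrM mulVf ?gt_eqF// powRr1 ?(ltW c1)// ler_pdivrMr; lra.
Qed.

End constants.

Lemma covering_numberP (R : realType) (T : Type) (rho : T -> T -> R) (e : R) :
  (exists n, covers rho e n) -> covers rho e (covering_number rho e).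
Proof.
rewrite /covering_number; case: pselect => // h _.
by case: ex_minnP => n /asboolP.
Qed.

(** * Coarse and fine levels of the chain *)

Section entropy_chain.
Context d (Omega : measurableType d) (R : realType) (P : probability Omega R).
Context (T : Type) (X : T -> Omega -> R) (alpha : R) (rho : T -> T -> R).
Context (Psi : R -> R) (r : T).
Hypotheses (alpha_gt0 : 0 < alpha) (alpha_lt2 : alpha < 2).
Hypothesis SaSX : SaS_process P alpha X.
Hypothesis scaleX : forall s t, SaS_scale P alpha (fun w => X t w - X s w) (rho s t).
Hypothesis rho_tb : totally_bounded_pm rho.
Hypothesis covPsi : forall e : R, 0 < e -> (covering_number rho e)%:R <= Psi e.
Local Notation stage := (stage P X alpha rho r).
Local Notation theta := (Psi_term alpha Psi).

Lemma covers_Psi (x : R) : 0 < x -> exists (n : nat) (g : 'I_n -> T),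
  (forall t, exists i, rho t (g i) <= x) /\ n%:R <= Psi x.
Proof.
move=> x0; have [g hg] := covering_numberP (rho_tb x0).
by exists (covering_number rho x), g; split => //; exact: covPsi.
Qed.

(** The point [r] has to be covered, so every net has at least one point. *)
Lemma covers_Psi_ge1 (x : R) : 0 < x -> 1 <= Psi x.
Proof.
move=> /covers_Psi[n [g [gc]]]; apply: le_trans.
by have [i _] := gc r; rewrite ler1n (leq_ltn_trans _ (ltn_ord i)).
Qed.

Lemma stage_le delta b b' q q' : stage delta b q -> b <= b' -> q' <= q ->
  stage delta b' q'.
Proof.
move=> [n [g [l [gc gl ql]]]] bb qq; exists n, g, l; split => //.
- by move=> i w lw; exact: le_trans (gl i w lw) bb.
- exact: le_trans ql.
Qed.

Lemma stage_refine delta b q a kappa delta' :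
  stage delta b q -> 0 <= q -> 0 < a -> 0 < delta' -> 0 <= kappa ->
  (forall p, 0 <= p -> p <= (delta * (2 / a)) `^ alpha ->
     expR (- kappa) <= sidak_factor alpha p) ->
  stage delta' (b + a) (q * expR (- (Psi delta' * kappa))).
Proof.
move=> st q0 a0 d0 k0 hk; have [n [g [gc nPsi]]] := covers_Psi d0.
have st' := stage_next alpha_gt0 scaleX st q0 a0 hk gc.
apply: (stage_le st') => //.
by apply: ler_wpM2l => //; rewrite ler_expR lerN2 ler_wpM2r.
Qed.

(** From radius 2^(j + 1) e to 2^j e with tolerance e / 2^j, twice the distance over the tolerance
    is at most 4^(j + 1); this costs (j + 1) L for each of at most Psi(2^j e) points. *)
Lemma coarse_stage (L e : R) m b q : 0 <= L -> 0 < e ->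
  (forall p j, 0 <= p -> p <= (4 ^+ j.+1) `^ alpha ->
    expR (- (j.+1%:R * L)) <= sidak_factor alpha p) ->
  0 <= q -> stage (2 ^+ m * e) b q ->
  stage e (b + \sum_(j < m) e / 2 ^+ j)
    (q * expR (- (L * \sum_(j < m) j.+1%:R * Psi (2 ^+ j * e)))).
Proof.
move=> L0 e0 hL; elim: m b q => [|m IH] b q q0.
  by rewrite !big_ord0 addr0 mulr0 oppr0 expR0 mulr1 mul1r.
move=> st; have n0 : 0 < 2 ^+ m :> R by rewrite exprn_gt0.
have a0 : 0 < e / 2 ^+ m by rewrite divr_gt0.
have st' := stage_refine (kappa := m.+1%:R * L) (delta' := 2 ^+ m * e) st q0 a0.
have {}st' : stage (2 ^+ m * e) (b + e / 2 ^+ m)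
    (q * expR (- (Psi (2 ^+ m * e) * (m.+1%:R * L)))).
  apply: st'; [by rewrite mulr_gt0|by rewrite mulr_ge0|] => p p0 pm.
  apply: hL => //; rewrite (_ : 4 ^+ m.+1 = 2 ^+ m.+1 * e * (2 / (e / 2 ^+ m)))//.
  rewrite (_ : 4 = 2 * 2 :> R); last by ring.
  by rewrite exprMn (exprS 2 m); field; rewrite !gt_eqF.
have := IH _ _ _ st'; rewrite mulr_ge0 ?expR_ge0// => /(_ isT).
rewrite !big_ord_recr/= -addrA (addrC (e / _)) -mulrA -expRD => h.
apply: (stage_le h) => //; apply: eq_ler.
by congr (_ * expR _); ring.
Qed.

(** The balance behind the choice of theta: as theta^(alpha + 1) = Psi(x) x^alpha, the total cost of
    a level is proportional to its tolerance. *)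
Lemma Psi_term_cost (x : R) : 0 < x -> Psi x * (x / theta x) `^ alpha = theta x.
Proof.
move=> x0; have t0 := Psi_term_gt0 alpha covers_Psi_ge1 x0.
have ta : 0 < theta x `^ alpha by exact: powR_gt0.
have tn : theta x `^ alpha != 0 by rewrite gt_eqF.
apply: (mulIf tn); rewrite -mulrA -powRM; last 2 first.
- by rewrite divr_ge0 ?ltW.
- exact: ltW.
rewrite divfK ?gt_eqF// -Psi_term_powR//; last exact: covers_Psi_ge1.
rewrite powRD; last by rewrite (gt_eqF t0) implybT.
by rewrite powRr1 ?ltW// mulrC.
Qed.

(** Level x = e / 2^(k + 1) gets tolerance e theta(x) / (2 h), the divisor being the later bound for
    the sum of the theta. Old net points are within 2 x, so the ratio is (8 h / e) (x / theta(x)),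
    and [Psi_term_cost] makes the cost of the level a multiple of theta(x). *)
Lemma fine_stage (e h b q : R) n : 0 < e -> 0 < h -> 0 <= q -> stage e b q ->
  stage (e / 2 ^+ n) (b + \sum_(k < n) e * theta (e / 2 ^+ k.+1) / (2 * h))
    (q * expR (- \sum_(k < n) bker_moment * (8 * h / e) `^ alpha * theta (e / 2 ^+ k.+1))).
Proof.
move=> e0 h0 q0 st; elim: n => [|n IH].
  by rewrite !big_ord0 addr0 oppr0 expR0 mulr1 expr0 divr1.
pose x := e / 2 ^+ n.+1.
have x0 : 0 < x by rewrite divr_gt0// exprn_gt0.
have t0 := Psi_term_gt0 alpha covers_Psi_ge1 x0.
have a0 : 0 < e * theta x / (2 * h) by rewrite divr_gt0 ?mulr_gt0.
have q1 : 0 <= q * expR (- \sum_(k < n) bker_moment * (8 * h / e) `^ alpha *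
    theta (e / 2 ^+ k.+1)).
  by rewrite mulr_ge0 ?expR_ge0.
have M0 := bker_moment_ge0 (R := R).
have k0 : 0 <= bker_moment * ((8 * h / e) `^ alpha * (x / theta x) `^ alpha).
  by apply: mulr_ge0 => //; rewrite mulr_ge0 ?powR_ge0.
have st' := stage_refine IH q1 a0 x0 k0.
apply: (stage_le (st' _)).
- move=> p p0 pn; apply: le_trans (sidak_factor_ge_expR alpha_gt0 alpha_lt2 p0).
  rewrite ler_expR lerN2; apply: ler_wpM2l => //; apply: (le_trans pn).
  rewrite -powRM; [|by rewrite divr_ge0 ?mulr_ge0 ?ltW|by rewrite divr_ge0 ?ltW].
  apply: eq_ler; congr (_ `^ _).
  have -> : e / 2 ^+ n = 2 * x by rewrite /x exprS invfM mulrCA mulVKf.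
  have tn : theta x != 0 by rewrite gt_eqF.
  have en : e != 0 by rewrite gt_eqF.
  have hn : h != 0 by rewrite gt_eqF.
  move: (theta x) tn => t tn; move: (x) => y; by field; rewrite tn en hn.
- by rewrite big_ord_recr/= addrA -/x.
- rewrite big_ord_recr/= -/x opprD expRD mulrA; apply: ler_wpM2l => //.
  rewrite ler_expR lerN2 -[X in _ <= _ * X](Psi_term_cost x0).
  by apply: eq_ler; ring.
Qed.

End entropy_chain.

(** * The small ball estimate for finite families *)

Section small_ball.
Context d (Omega : measurableType d) (R : realType) (P : probability Omega R).
Context (T : Type) (X : T -> Omega -> R) (alpha C1 : R) (rho : T -> T -> R).
Context (Psi : R -> R) (r : T).
Hypotheses (alpha_gt0 : 0 < alpha) (alpha_lt2 : alpha < 2) (C1_gt1 : 1 < C1).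
Hypothesis SaSX : SaS_process P alpha X.
Hypothesis scaleX : forall s t, SaS_scale P alpha (fun w => X t w - X s w) (rho s t).
Hypothesis rho_bd : has_ubound (range (fun p : T * T => rho p.1 p.2)).
Hypothesis rho_tb : totally_bounded_pm rho.
Hypothesis covPsi : forall e : R, 0 < e -> (covering_number rho e)%:R <= Psi e.
Hypothesis Psi_noninc : forall x y : R, 0 < x -> x <= y -> Psi y <= Psi x.
Hypothesis Psi_cont : forall x : R, 0 < x -> {for x, continuous Psi}.
Hypothesis Psi_growth : forall e : R, 0 < e -> e <= diam_pm rho ->
  C1 * Psi e <= Psi (e / 2).
Local Notation stage := (stage P X alpha rho r).
Local Notation theta := (Psi_term alpha Psi).
Let Psi_ge1 := covers_Psi_ge1 r rho_tb covPsi.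

Lemma rho_le_diam s t : rho s t <= diam_pm rho.
Proof. by apply: ub_le_sup => //; exists (s, t). Qed.

(** Iterates the growth condition, which is available only up to the diameter. *)
Lemma Psi_pow2_le (e : R) m j : 0 < e -> (forall i, (i < m)%N -> 2 ^+ i * e < diam_pm rho) ->
  (j < m)%N -> Psi (2 ^+ j * e) <= C1^-1 ^+ j * Psi e.
Proof.
move=> e0 hm; elim: j => [|j IH] jm; first by rewrite !expr0 !mul1r.
have c0 : 0 < C1 by apply: lt_trans C1_gt1.
have j0 : 0 < 2 ^+ j.+1 * e by rewrite mulr_gt0// exprn_gt0.
have := Psi_growth j0 (ltW (hm _ jm)).
have -> : 2 ^+ j.+1 * e / 2 = 2 ^+ j * e by rewrite exprS; field.
move=> h; rewrite (exprS C1^-1) -mulrA ler_pdivlMl// (le_trans h)// IH//.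
exact: ltnW.
Qed.

Lemma root_stage (L e : R) : 0 <= L -> 0 < e ->
  (forall p j, 0 <= p -> p <= (4 ^+ j.+1) `^ alpha ->
    expR (- (j.+1%:R * L)) <= sidak_factor alpha p) ->
  stage e (2 * e) (expR (- (L * (((1 - C1^-1) ^+ 2)^-1 * Psi e)))).
Proof.
move=> L0 e0 hL.
have exm : exists m, diam_pm rho <= 2 ^+ m * e.
  exists (Num.truncn (diam_pm rho / e)).+1; rewrite -ler_pdivrMr//.
  apply: ltW; apply: (lt_trans (truncnS_gt _)).
  by rewrite -natrX ltr_nat ltn_expl.
(* With [m] minimal, [r] alone is a net of radius 2^m e, while the radii 2^i e with i < m stay below
   the diameter. *)
case: (ex_minnP exm) => m hm mmin.
have hlt i : (i < m)%N -> 2 ^+ i * e < diam_pm rho.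
  by move=> im; rewrite ltNge; apply/negP => /mmin; rewrite leqNgt im.
have top : stage (2 ^+ m * e) 0 1.
  exists 1%N, (fun=> r), [::]; split => [t|i w _|].
  - by exists ord0; apply: le_trans hm; exact: rho_le_diam.
  - by rewrite subrr normr0.
  - by rewrite big_nil.
have c0 : 0 < C1 by apply: lt_trans C1_gt1.
have := coarse_stage alpha_gt0 scaleX rho_tb covPsi L0 e0 hL ler01 top.
move=> st; apply: (stage_le st); first by rewrite add0r; apply: sum_half_le; exact: ltW.
rewrite mul1r ler_expR lerN2; apply: ler_wpM2l => //.
apply: (@le_trans _ _ (\sum_(j < m) (j.+1%:R * C1^-1 ^+ j) * Psi e)).
  apply: ler_sum => j _; rewrite -mulrA; apply: ler_wpM2l => //.
  by apply: Psi_pow2_le hlt _.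
rewrite -mulr_suml; apply: ler_wpM2r; first exact: le_trans (Psi_ge1 e0).
apply: sum_arith_geom_le; first by rewrite invr_ge0 ltW.
by rewrite invf_lt1.
Qed.

(** Raising theta(e) <= 2 h to the power alpha + 1 expresses the coarse cost, a multiple of Psi(e),
    through the target quantity. *)
Lemma Psi_le_Psi_hat (e h : R) : 0 < e -> 0 < h -> theta e <= 2 * h ->
  Psi e <= 2 `^ (alpha + 1) * (e `^ (- alpha) * h `^ (alpha + 1)).
Proof.
move=> e0 h0 th; have ea : 0 < e `^ alpha by exact: powR_gt0.
rewrite powRN -(ler_pM2r ea) -(Psi_term_powR alpha_gt0 Psi_ge1 e0).
have -> : 2 `^ (alpha + 1) * ((e `^ alpha)^-1 * h `^ (alpha + 1)) * e `^ alpha =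
    2 `^ (alpha + 1) * h `^ (alpha + 1) by field; rewrite gt_eqF.
rewrite -powRM ?(ltW h0)//; apply: ge0_ler_powR => //.
- by rewrite ltW// alphaD1_gt0.
- by rewrite nnegrE ltW// Psi_term_gt0.
- by rewrite nnegrE mulr_ge0// ltW.
Qed.

Lemma fine_cost (e h : R) : 0 < e -> 0 < h ->
  (8 * h / e) `^ alpha * (2 * h) = 2 * 8 `^ alpha * (e `^ (- alpha) * h `^ (alpha + 1)).
Proof.
move=> e0 h0; rewrite powRM ?invr_ge0 ?mulr_ge0 ?(ltW e0) ?(ltW h0)//.
rewrite powRM ?(ltW h0)// powRD; last by rewrite (gt_eqF h0) implybT.
rewrite powRr1 ?(ltW h0)//.
have -> : e^-1 `^ alpha = e `^ (- alpha) by rewrite -powR_inv1 ?(ltW e0)// -powRrM mulN1r.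
ring.
Qed.

Lemma chain_stage (L e h : R) n : 0 <= L -> 0 < e -> 0 < h ->
  (forall p j, 0 <= p -> p <= (4 ^+ j.+1) `^ alpha ->
    expR (- (j.+1%:R * L)) <= sidak_factor alpha p) ->
  Psi_hat alpha Psi e = h%:E ->
  stage (e / 2 ^+ n) (3 * e) (expR (- (L * (((1 - C1^-1) ^+ 2)^-1 * Psi e) +
    2 * bker_moment * 8 `^ alpha * (e `^ (- alpha) * h `^ (alpha + 1))))).
Proof.
move=> L0 e0 h0 hL hE.
have M0 := bker_moment_ge0 (R := R).
have ek k : 0 < e / 2 ^+ k by rewrite divr_gt0// exprn_gt0.
have S : \sum_(k < n) theta (e / 2 ^+ k.+1) <= 2 * h.
  (* The fine levels start at e / 2, so the first of the n + 1 terms is dropped. *)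
  have := sum_Psi_term_le alpha_gt0 Psi_ge1 Psi_noninc Psi_cont n.+1 e0 hE.
  rewrite big_ord_recl; apply: le_trans; rewrite lerDr ltW// Psi_term_gt0//.
have h2 : 0 < 2 * h by rewrite mulr_gt0.
have := fine_stage alpha_gt0 alpha_lt2 scaleX rho_tb covPsi n e0 h0 (expR_ge0 _)
  (root_stage L0 e0 hL).
move=> st; apply: (stage_le st).
  rewrite -mulr_suml -mulr_sumr (_ : 3 * e = 2 * e + e); last by ring.
  by rewrite lerD2l ler_pdivrMr// ler_wpM2l// ltW.
rewrite -expRD ler_expR -opprD lerN2 lerD2l -mulr_sumr.
have -> : 2 * bker_moment * 8 `^ alpha * (e `^ (- alpha) * h `^ (alpha + 1)) =
  bker_moment * (2 * 8 `^ alpha * (e `^ (- alpha) * h `^ (alpha + 1))) :> R by ring.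
rewrite -fine_cost// -mulrA; apply: ler_wpM2l => //; apply: ler_wpM2l => //.
exact: powR_ge0.
Qed.

(** The chain runs down to a net so fine that linking the n given points to it costs at most 1 in
    total, which frees the bound of n. Tolerances: 2 e for the coarse levels, e for the fine ones, e
    for the last link. *)
Lemma small_ball_finite (L e h : R) n (g : 'I_n -> T) : 0 <= L -> 0 < e ->
  (forall p j, 0 <= p -> p <= (4 ^+ j.+1) `^ alpha ->
    expR (- (j.+1%:R * L)) <= sidak_factor alpha p) ->
  Psi_hat alpha Psi e = h%:E ->
  ((expR (- (((L * ((1 - C1^-1) ^+ 2)^-1 + 1) * 2 `^ (alpha + 1)
     + 2 * bker_moment * 8 `^ alpha) * e `^ (- alpha) * h `^ (alpha + 1))))%:E <=
   P [set w | forall i, (`|X (g i) w - X r w| <= 4 * e)%R])%E.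
Proof.
move=> L0 e0 hL hE.
have th : theta e <= 2 * h.
  have := sum_Psi_term_le alpha_gt0 Psi_ge1 Psi_noninc Psi_cont 1 e0 hE.
  by rewrite big_ord1 expr0 divr1.
have h0 : 0 < h.
  by rewrite -(pmulr_rgt0 _ (ltr0n R 2)) (lt_le_trans _ th)// Psi_term_gt0.
have M0 := bker_moment_ge0 (R := R).
have [m hm] := half_pow_powR_le alpha_gt0 (mulr_ge0 (ler0n R n) M0).
have st := chain_stage m L0 e0 h0 hL hE.
have [|l [lc lq]] := stage_extend alpha_gt0 scaleX g st (expR_ge0 _) e0
  (kappa := bker_moment * (2 / 2 ^+ m) `^ alpha).
  move=> p p0 pm; apply: le_trans (sidak_factor_ge_expR alpha_gt0 alpha_lt2 p0).
  rewrite ler_expR lerN2; apply: ler_wpM2l => //; apply: (le_trans pm).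
  apply: eq_ler; congr (_ `^ _).
  by field; rewrite (gt_eqF e0) expf_neq0.
have mS : measurable [set w | forall i, `|X (g i) w - X r w| <= 4 * e].
  rewrite (_ : mkset _ = \bigcap_(i in [set: 'I_n]) [set w | `|X (g i) w - X r w| <= 4 * e]).
    by apply: fin_bigcap_measurable => // i _; apply: measurable_normB_le; exact: SaSX.1.
  by apply/seteqP; split => w /= hw i => [_|]; exact: hw.
apply: (@le_trans _ _ (P [set w | all (fun z => `|lincomb X z w| <= 2)%R l])%E); last first.
  apply: le_measure; rewrite ?inE//; first exact: measurable_all_lin SaSX _.
  move=> w lw i; have := lc i w lw; rewrite (_ : 3 * e + e = 4 * e)//; ring.
apply: le_trans (sidak alpha_gt0 SaSX l); rewrite lee_fin; apply: le_trans lq.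
rewrite -expRD ler_expR -opprD lerN2.
have Y0 := Psi_le_Psi_hat e0 h0 th.
set Y := e `^ (- alpha) * h `^ (alpha + 1) in Y0 *.
have -> (a b c : R) : ((a + 1) * b + c) * e `^ (- alpha) * h `^ (alpha + 1) =
  a * (b * Y) + c * Y + b * Y by rewrite /Y; ring.
have P1 := Psi_ge1 e0.
(* The last link costs at most 1 <= Psi(e), which accounts for the summand 1 in the constant. *)
apply: lerD; last by rewrite mulrA; lra.
rewrite lerD2r [leLHS]mulrA; apply: ler_wpM2l => //.
by rewrite mulr_ge0// invr_ge0 sqr_ge0.
Qed.

End small_ball.

Theorem theorem5 (R : realType) :
  exists K0 : R, 0 < K0 /\
  forall (alpha C1 : R), 0 < alpha -> alpha < 2 -> 1 < C1 ->
  exists K : R, 0 < K /\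
  forall (T : Type) (d : measure_display) (Omega : measurableType d)
         (P : probability Omega R) (X : T -> Omega -> R)
         (rho : T -> T -> R) (Psi : R -> R),
    (exists t : T, True) ->
    SaS_process P alpha X ->
    separable_process P rho X ->
    (forall s t : T, SaS_scale P alpha (fun w => X t w - X s w) (rho s t)) ->
    has_ubound (range (fun p : T * T => rho p.1 p.2)) ->
    totally_bounded_pm rho ->
    (forall eps : R, 0 < eps -> (covering_number rho eps)%:R <= Psi eps) ->
    (forall x y : R, 0 < x -> x <= y -> Psi y <= Psi x) ->
    (forall x : R, 0 < x -> {for x, continuous Psi}) ->
    (forall eps : R, 0 < eps -> eps <= diam_pm rho ->
       C1 * Psi eps <= Psi (eps / 2)) ->
    forall (eps h : R), 0 < eps -> Psi_hat alpha Psi eps = h%:E ->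
    exists A : set Omega, measurable A /\
      A `<=` [set w | forall s t : T, `|X s w - X t w| <= K0 * eps] /\
      ((expR (- (K * eps `^ (- alpha) * h `^ (alpha + 1))))%:E <= P A)%E.
Proof.
(* 8 = 2 * 4: finite families have tolerance 4 e, and comparing two points through the root doubles
   it. *)
exists 8; split => // alpha C1 a0 a2 c1.
have [L L0 hL] := @coarse_cost R.
(* [L] and [bker_moment] are universal, so this constant depends on alpha and C1 only. *)
exists ((L * ((1 - C1^-1) ^+ 2)^-1 + 1) * 2 `^ (alpha + 1)
     + 2 * bker_moment * 8 `^ alpha); split.
  rewrite ltr_pwDl//.
    by rewrite mulr_gt0 ?powR_gt0// ltr_wpDl// mulr_ge0 ?(ltW L0)// invr_ge0 sqr_ge0.
  apply: mulr_ge0; last exact: powR_ge0.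
  by apply: mulr_ge0 => //; exact: bker_moment_ge0.
move=> T d Omega P X rho Psi [r _] SX sepX sc rb rt cP Pn Pc Pg e h e0 hE.
have -> : 8 * e = 2 * (4 * e) by ring.
apply: (separable_small_ball (r := r) SX.1 sepX).
move=> n g; apply: (small_ball_finite r a0 a2 c1 SX sc rb rt cP Pn Pc Pg g (ltW L0) e0 _ hE).
by move=> p j; exact: hL.
Qed.
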